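(* Let $\mathcal{R}$ be a rule (of some order $k\in\mathbb{N}$). (i) For each kernel $W\in\mathcal{W}$ there is an open interval $\mathcal{D}_W\subseteq\mathbb{R}$ containing $0$ and a trajectory $\Phi^{\cdot}W:\mathcal{D}_W\to\mathcal{W}$ starting at $W$ such that any other trajectory starting at $W$ is a restriction of $\Phi^{\cdot}W$ to a subinterval of $\mathcal{D}_W$. (ii) For any $W\in\mathcal{W}$ and any $u\in\mathcal{D}_W$ we have $\mathcal{D}_{\Phi^uW}=\{t\in\mathbb{R}: t+u\in\mathcal{D}_W\}$, and for every $t\in\mathcal{D}_{\Phi^uW}$ we have $\Phi^t\Phi^uW=\Phi^{t+u}W$. (iii) Whenever $W\in\mathcal{W}_0$, the set $I_W:=\{t\in\mathcal{D}_W:\Phi^tW\in\mathcal{W}_0\}$ is a closed interval containing $[0,\infty)$.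
   Context: $(\Omega,\pi)$ is a fixed atomless probability space whose sigma-algebra is separable (there is a countable family $\mathcal{C}$ of measurable sets such that for every measurable $S$ and $\delta>0$ some $T\in\mathcal{C}$ has $\pi(S\ominus T)<\delta$, where $\ominus$ is symmetric difference). $\mathcal{W}$ is the Banach space of kernels: bounded measurable functions $W:\Omega^2\to\mathbb{R}$ with $W(x,y)=W(y,x)$ a.e., identified when equal a.e., with the $L^\infty$-norm $\|\cdot\|_\infty$. $\mathcal{W}_0\subset\mathcal{W}$ is the set of graphons: kernels with values in $[0,1]$ a.e. $\mathcal{H}_k$ is the set of all (simple, labelled) graphs on vertex set $[k]=\{1,\dots,k\}$. A rule of order $k$ is a matrix $\mathcal{R}\in[0,1]^{\mathcal{H}_k\times\mathcal{H}_k}$ with $\sum_{J\in\mathcal{H}_k}\mathcal{R}_{H,J}=1$ for every $H\in\mathcal{H}_k$. For $F\in\mathcal{H}_k$, distinct $a,b\in[k]$ and $W\in\mathcal{W}$ define $$(T_F^{a,b}W)(x,y)=\int\prod_{ij\in E(F)}W(x_i,x_j)\prod_{ij\notin E(F)}(1-W(x_i,x_j))\prod_{i\in[k]\setminus\{a,b\}}\pi(\mathrm{d}x_i),\quad x_a=x,\ x_b=y,$$ where $ij$ ranges over unordered pairs of distinct elements of $[k]$. The velocity operator $\mathfrak{V}=\mathfrak{V}_{\mathcal{R}}:\mathcal{W}\to\mathcal{W}$ is $$\mathfrak{V}_{\mathcal{R}}W=\sum_{F,H\in\mathcal{H}_k}\mathcal{R}_{F,H}\sum_{1\le a\ne b\le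 k}T_F^{a,b}W\cdot\left(\mathbb{I}_{\{ab\in E(H)\setminus E(F)\}}-\mathbb{I}_{\{ab\in E(F)\setminus E(H)\}}\right),$$ the inner sum being over ordered pairs $(a,b)$ of distinct elements. A trajectory starting at $W\in\mathcal{W}$ is a function $\Phi^{\cdot}W:I\to(\mathcal{W},\|\cdot\|_\infty)$, defined on an open interval $I\subseteq\mathbb{R}$ containing $0$ and differentiable with respect to $\|\cdot\|_\infty$, such that $\frac{\mathrm{d}}{\mathrm{d}t}\Phi^tW=\mathfrak{V}\Phi^tW$ for $t\in I$ and $\Phi^0W=W$. *)

(* Defs.v *)
From HB Require Import structures.
From mathcomp Require Import all_boot all_order all_algebra.
From mathcomp Require Import all_classical all_reals all_analysis.
From mathcomp Require Import measurable_realfun ess_sup_inf.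

Set Implicit Arguments.
Unset Strict Implicit.
Unset Printing Implicit Defensive.
Import Order.TTheory GRing.Theory Num.Theory.
Import numFieldNormedType.Exports.

Local Open Scope classical_set_scope.
Local Open Scope ring_scope.

Definition atomless d (T : measurableType d) (R : realType)
    (P : probability T R) :=
  forall A : set T, measurable A -> (0 < P A)%E ->
    exists B : set T, [/\ measurable B, B `<=` A & (0 < P B < P A)%E].

Definition separable d (T : measurableType d) (R : realType)
    (P : probability T R) :=
  exists C : set (set T), [/\ countable C, C `<=` measurable &
    forall (S : set T) (delta : R), measurable S -> 0 < delta ->
      exists2 A, C A & (P (S `+` A) < delta%:E)%E].

Section KernelSpace.
Context d (T : measurableType d) (R : realType) (P : probability T R).
Notation PP := (P \x P)%E.

Definition is_kernel_fun (W : T * T -> R) := [/\ measurable_fun setT W,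
  bounded_fun W & {ae PP, forall z, W z = W (z.2, z.1)}].

Definition kernel_fun_pred : {pred (T * T -> R)} :=
  [pred W | `[< is_kernel_fun W >]].

Lemma bounded_funP (X : Type) (f : X -> R) :
  bounded_fun f <-> exists M : R, forall x, `|f x| <= M.
Proof.
split=> [[M [_ fM]]|[M fM]].
  by exists (M + 1) => x; apply: fM => //; rewrite ltrDl.
by exists M; split; rewrite ?num_real// => N MN x _;
  exact: le_trans (fM x) (ltW MN).
Qed.

Lemma kernel_fun_submod_closed : submod_closed kernel_fun_pred.
Proof.
split=> [|a f g /asboolP[mf /bounded_funP[M fM] sf]
              /asboolP[mg /bounded_funP[N gN] sg]]; apply/asboolP; split.
- exact: measurable_cst.
- by apply/bounded_funP; exists 0 => x; rewrite normr0.
- exact/nearW.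
- by apply: measurable_funD => //; exact: measurable_funM.
- apply/bounded_funP; exists (`|a| * M + N) => x.
  rewrite (le_trans (ler_normD _ _))// lerD//.
  by rewrite normrM ler_wpM2l.
- by apply: filterS2 sf sg => z /= fz gz;
  rewrite /GRing.add/= /GRing.scale/= fz gz.
Qed.

HB.instance Definition _ :=
  GRing.isSubmodClosed.Build R (T * T -> R) kernel_fun_pred
    kernel_fun_submod_closed.

Record kernel_fun := KernelFun {
  kernel_fun_val :> T * T -> R;
  _ : kernel_fun_val \in kernel_fun_pred }.

HB.instance Definition _ := [isSub for kernel_fun_val].
HB.instance Definition _ := [Choice of kernel_fun by <:].
HB.instance Definition _ := [SubChoice_isSubLmodule of kernel_fun by <:].

Lemma kernel_funP (W : kernel_fun) : is_kernel_fun W.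
Proof. exact/asboolP/(valP W). Qed.

Definition kernel_eq (V W : kernel_fun) := `[< V = W %[ae PP] >].

Lemma kernel_eq_refl : reflexive kernel_eq.
Proof. by move=> W; apply/asboolP/nearW. Qed.

Lemma kernel_eq_sym : symmetric kernel_eq.
Proof.
by move=> V W; apply/idP/idP => /asboolP h; apply/asboolP;
  apply: filterS h => z /[apply].
Qed.

Lemma kernel_eq_trans : transitive kernel_eq.
Proof.
move=> V U W /asboolP UV /asboolP VW; apply/asboolP.
by apply: filterS2 UV VW => z /[swap] ? -> // ->.
Qed.

Canonical kernel_eq_equiv :=
  EquivRel kernel_eq kernel_eq_refl kernel_eq_sym kernel_eq_trans.

Local Open Scope quotient_scope.

Definition kernel_space : Type := {eq_quot kernel_eq}.
HB.instance Definition _ := Choice.on kernel_space.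
HB.instance Definition _ := EqQuotient.on kernel_space.

Implicit Types U V W : kernel_space.

Lemma kernel_eqP (f g : kernel_fun) :
  (\pi_kernel_space f = \pi_kernel_space g) <-> {ae PP, forall z, f z = g z}.
Proof.
split=> [/eqmodP/asboolP|] h.
  by apply: filterS h => z; exact.
by apply/eqmodP/asboolP; apply: filterS h.
Qed.

Lemma repr_pi_kernel (f : kernel_fun) :
  {ae PP, forall z, repr (\pi_kernel_space f) z = f z}.
Proof. by apply/kernel_eqP; rewrite reprK. Qed.

Definition kernel_zero : kernel_space := \pi_kernel_space 0.
Definition kernel_opp W : kernel_space := \pi_kernel_space (- repr W).
Definition kernel_add V W : kernel_space := \pi_kernel_space (repr V + repr W).
Definition kernel_scale (a : R) W : kernel_space :=
  \pi_kernel_space (a *: repr W).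

Lemma pi_kernelN f : \pi_kernel_space (- f) = kernel_opp (\pi_kernel_space f).
Proof.
apply/kernel_eqP; apply: filterS (repr_pi_kernel f) => z /= e.
by rewrite /GRing.opp/= e.
Qed.

Lemma pi_kernelD f g :
  \pi_kernel_space (f + g) =
    kernel_add (\pi_kernel_space f) (\pi_kernel_space g).
Proof.
apply/kernel_eqP; apply: filterS2 (repr_pi_kernel f) (repr_pi_kernel g).
by move=> z /= ef eg; rewrite /GRing.add/= ef eg.
Qed.

Lemma pi_kernelZ a f : \pi_kernel_space (a *: f) =
  kernel_scale a (\pi_kernel_space f).
Proof.
apply/kernel_eqP; apply: filterS (repr_pi_kernel f) => z /= e.
by rewrite /GRing.scale/= e.
Qed.

Lemma kernel_addA : associative kernel_add.
Proof.
elim/quotW => u; elim/quotW => v; elim/quotW => w.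
by rewrite -(pi_kernelD v w) -(pi_kernelD u v) -2!pi_kernelD addrA.
Qed.

Lemma kernel_addC : commutative kernel_add.
Proof. by move=> V W; rewrite /kernel_add addrC. Qed.

Lemma kernel_add0 : left_id kernel_zero kernel_add.
Proof. by elim/quotW => w; rewrite -pi_kernelD add0r. Qed.

Lemma kernel_addN : left_inverse kernel_zero kernel_opp kernel_add.
Proof. by elim/quotW => w; rewrite -pi_kernelN -pi_kernelD addNr. Qed.

HB.instance Definition _ := GRing.isZmodule.Build kernel_space
  kernel_addA kernel_addC kernel_add0 kernel_addN.

Lemma kernel_scaleA a b W :
  kernel_scale a (kernel_scale b W) = kernel_scale (a * b) W.
Proof.
by elim/quotW: W => w; rewrite -(pi_kernelZ b) -2!pi_kernelZ scalerA.
Qed.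

Lemma kernel_scale1 : left_id 1 kernel_scale.
Proof. by elim/quotW => w; rewrite -pi_kernelZ scale1r. Qed.

Lemma kernel_scaleDr : right_distributive kernel_scale +%R.
Proof.
move=> a; elim/quotW => v; elim/quotW => w.
rewrite /GRing.add/= -(pi_kernelZ a v) -(pi_kernelZ a w) -2!pi_kernelD.
by rewrite -pi_kernelZ scalerDr.
Qed.

Lemma kernel_scaleDl W : {morph kernel_scale^~ W : a b / a + b}.
Proof.
move=> a b; elim/quotW: W => w.
by rewrite /GRing.add/= -3!pi_kernelZ -pi_kernelD -scalerDl.
Qed.

HB.instance Definition _ := GRing.Zmodule_isLmodule.Build R kernel_space
  kernel_scaleA kernel_scale1 kernel_scaleDr kernel_scaleDl.

Definition kernel_norm W : R := fine ('N[PP]_(+oo)[EFin \o repr W])%E.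


Lemma PP_gt0 : (0 < PP setT)%E.
Proof.
have -> : (PP setT = P setT * P setT)%E by rewrite -setXTT product_measure1E.
by rewrite probability_setT mule1 lte01.
Qed.

Lemma kernel_ess_sup W : (('N[PP]_(+oo)[EFin \o repr W])%E
  = ess_sup PP (fun z => `|(repr W z)%:E|))%E.
Proof. by rewrite unlock PP_gt0. Qed.

Lemma kernel_normE W :
  ((kernel_norm W)%:E = 'N[PP]_(+oo)[EFin \o repr W])%E.
Proof.
rewrite /kernel_norm fineK// fin_numElt (lt_le_trans ltNy0) ?Lnorm_ge0//=.
have [_ /bounded_funP[M WM] _] := kernel_funP (repr W).
rewrite kernel_ess_sup (@le_lt_trans _ _ M%:E) ?ltry//.
by apply/ess_supP/nearW => z; rewrite lee_fin.
Qed.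

Lemma kernel_norm_leP W (M : R) :
  kernel_norm W <= M <-> {ae PP, forall z, `|repr W z| <= M}.
Proof.
rewrite -lee_fin kernel_normE kernel_ess_sup; split=> [/ess_supP|WM].
  by apply: filterS => z /=; rewrite lee_fin.
by apply/ess_supP; apply: filterS WM => z /=; rewrite lee_fin.
Qed.

Lemma kernel_normP W : {ae PP, forall z, `|repr W z| <= kernel_norm W}.
Proof. exact/kernel_norm_leP. Qed.

Lemma repr_kernelD V W :
  {ae PP, forall z, repr (V + W) z = repr V z + repr W z}.
Proof. exact: (repr_pi_kernel (repr V + repr W)). Qed.

Lemma repr_kernelZ a W : {ae PP, forall z, repr (a *: W) z = a * repr W z}.
Proof. exact: (repr_pi_kernel (a *: repr W)). Qed.

Lemma ler_kernel_normD V W :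
  kernel_norm (V + W) <= kernel_norm V + kernel_norm W.
Proof.
apply/kernel_norm_leP; near=> z.
have -> : repr (V + W) z = repr V z + repr W z by near: z; exact: repr_kernelD.
rewrite (le_trans (ler_normD _ _))// lerD//; near: z; exact: kernel_normP.
Unshelve. all: by end_near. Qed.

Lemma ler_kernel_normZ a W : kernel_norm (a *: W) <= `|a| * kernel_norm W.
Proof.
apply/kernel_norm_leP; near=> z.
have -> : repr (a *: W) z = a * repr W z by near: z; exact: repr_kernelZ.
by rewrite normrM ler_wpM2l//; near: z; exact: kernel_normP.
Unshelve. all: by end_near. Qed.

Lemma kernel_normZ a W : kernel_norm (a *: W) = `|a| * kernel_norm W.
Proof.
apply/le_anti; rewrite ler_kernel_normZ/=.
have [->|a0] := eqVneq a 0.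
  by rewrite normr0 mul0r -lee_fin kernel_normE Lnorm_ge0.
rewrite -ler_pdivlMl ?normr_gt0// -normfV.
by rewrite (le_trans _ (ler_kernel_normZ _ _))// scalerA mulVf// scale1r.
Qed.

Lemma kernel_norm_eq0 W : kernel_norm W = 0 -> W = 0.
Proof.
move=> W0; rewrite -[W]reprK; apply/kernel_eqP.
apply: filterS (kernel_normP W) => z; rewrite W0 normr_le0 => /eqP ->.
by [].
Qed.

HB.instance Definition _ := Lmodule_isNormed.Build R kernel_space
  ler_kernel_normD kernel_normZ kernel_norm_eq0.

Definition graphon W := {ae PP, forall z, 0 <= repr W z <= 1}.

End KernelSpace.

Arguments kernel_space {d T R} P.

Definition graph (k : nat) : Type :=
  {E : {set {set 'I_k}} | [forall e in E, #|e| == 2]}.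

Definition edge k (F : graph k) (i j : 'I_k) := [set i; j]%SET \in val F.

Definition is_rule (R : realType) k (r : graph k -> graph k -> R) :=
  (forall F H, 0 <= r F H <= 1) /\ (forall F, \sum_H r F H = 1).

Section IteratedIntegral.
Context d (T : measurableType d) (R : realType) (P : probability T R).

Fixpoint iterated_integral (I : eqType) (s : seq I) (f : (I -> T) -> R)
    (x : I -> T) : R :=
  if s is i :: s' then
    \int[P]_t iterated_integral s' f [eta x with i |-> t]
  else f x.

Lemma measurable_Rintegral_param d' (Z : measurableType d') (g : Z * T -> R) :
  measurable_fun setT g -> measurable_fun setT (fun z => \int[P]_t g (z, t)).
Proof.
move=> mg; apply: (measurableT_comp (fine_measurable measurableT)) => //=.
under eq_fun do rewrite integralE.
have mG : measurable_fun setT (EFin \o g) by exact/measurable_EFinP.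
apply: emeasurable_funB.
- rewrite (_ : (fun _ => _) = fubini_F P (EFin \o g)^\+%E).
    exact: (measurable_fun_fubini_tonelli_F _ (measurable_funepos mG)).
  by apply/funext => z; apply: eq_integral => t _; rewrite !funeposE.
- rewrite (_ : (fun _ => _) = fubini_F P (EFin \o g)^\-%E).
    exact: (measurable_fun_fubini_tonelli_F _ (measurable_funeneg mG)).
  by apply/funext => z; apply: eq_integral => t _; rewrite !funenegE.
Qed.

Definition coordinatewise_measurable (I : eqType) (f : (I -> T) -> R) :=
  forall d' (Z : measurableType d') (phi : Z -> I -> T),
    (forall i, measurable_fun setT (phi^~ i)) -> measurable_fun setT (f \o phi).

Lemma iterated_integral_measurable (I : eqType) (s : seq I) f :
  coordinatewise_measurable f ->
  coordinatewise_measurable (iterated_integral s f).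
Proof.
move=> mf; elim: s => [|i s IHs] d' Z phi mphi; first exact: mf.
pose phi' (zt : Z * T) := [eta phi zt.1 with i |-> zt.2].
apply: (@measurable_Rintegral_param _ _ (iterated_integral s f \o phi')).
apply: IHs => j; rewrite /phi'/=; case: (j == i); first exact: measurable_snd.
exact: (measurableT_comp (mphi j) measurable_fst).
Qed.

Lemma normr_Rintegral_le (f : T -> R) (M : R) : measurable_fun setT f ->
  (forall t, `|f t| <= M) -> `|\int[P]_t f t| <= M.
Proof.
move=> mf fM.
have icst : P.-integrable setT (EFin \o cst M).
  exact: finite_measure_integrable_cst.
have iF : P.-integrable setT (EFin \o f).
  apply: le_integrable icst => //; first exact/measurable_EFinP.
  by move=> t _ /=; rewrite lee_fin (le_trans (fM t))// ler_norm.
rewrite (le_trans (le_normr_Rintegral _ _))//.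
rewrite (le_trans (@le_Rintegral _ _ _ P setT _ (cst M) _ _ _ _))//.
  exact: integrable_norm.
rewrite Rintegral_cst// [X in _ * X](_ : _ = 1) ?mulr1//.
exact: (congr1 fine (probability_setT P)).
Qed.

Lemma iterated_integral_bounded (I : eqType) (s : seq I) f (M : R) :
  coordinatewise_measurable f -> (forall x, `|f x| <= M) ->
  forall x, `|iterated_integral s f x| <= M.
Proof.
move=> mf fM; elim: s => [|i s IHs] x //=.
apply: normr_Rintegral_le => [|t]; last exact: IHs.
apply: (@iterated_integral_measurable I s f mf _ T
  (fun t => [eta x with i |-> t])) => j /=.
by case: (j == i); [exact: measurable_id|exact: measurable_cst].
Qed.

Lemma eq_iterated_integral (I : eqType) (s : seq I) f (x y : I -> T) :
  {in [predC s], x =1 y} -> iterated_integral s f x = iterated_integral s f y.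
Proof.
elim: s x y => [|i s IHs] x y xy /=.
  by congr f; apply/funext => j; exact: xy.
apply: eq_Rintegral => t _; apply: IHs => j js /=.
by case: eqP => // /eqP ji; apply: xy; rewrite !inE negb_or ji.
Qed.

End IteratedIntegral.

Lemma big_closed (X I : Type) (R : Type) (op : R -> R -> R) (idx : R)
    (Q : (X -> R) -> Prop) (s : seq I) (A : pred I) (h : I -> X -> R) :
  Q (fun=> idx) ->
  (forall f g, Q f -> Q g -> Q (fun x => op (f x) (g x))) ->
  (forall i, A i -> Q (h i)) -> Q (fun x => \big[op/idx]_(i <- s | A i) h i x).
Proof.
move=> Q0 Qop Qh; elim: s => [|i s IHs].
  by under eq_fun do rewrite big_nil.
have [Ai|/negbTE Ai] := boolP (A i); under eq_fun do rewrite big_cons Ai.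
  by apply: Qop => //; exact: Qh.
exact: IHs.
Qed.

Section Velocity.
Context d (T : measurableType d) (R : realType) (P : probability T R).
Notation PP := (P \x P)%E.

Definition graph_density k (F : graph k) (W : T * T -> R) (x : 'I_k -> T) : R :=
  (\prod_(i < k) \prod_(j < k | (i < j)%N && edge F i j) W (x i, x j)) *
  (\prod_(i < k) \prod_(j < k | (i < j)%N && ~~ edge F i j) (1 - W (x i, x j))).

(* All coordinates of the starting point other than a and b are overwritten by
   the integration, so their initial values do not matter. *)
Definition rooted_density k (F : graph k) (a b : 'I_k) (W : T * T -> R)
    (z : T * T) : R :=
  iterated_integral P [seq i <- enum 'I_k | (i != a) && (i != b)]
    (graph_density F W) (fun i => if i == a then z.1 else z.2).

Definition velocity_fun k (r : graph k -> graph k -> R) (W : T * T -> R)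
    (z : T * T) : R :=
  \sum_(F : graph k) \sum_(H : graph k) r F H *
    \sum_(a < k) \sum_(b < k | a != b) rooted_density F a b W z *
      ((edge H a b && ~~ edge F a b)%:R - (edge F a b && ~~ edge H a b)%:R).

Lemma edgeC k (F : graph k) i j : edge F i j = edge F j i.
Proof. by rewrite /edge finset.setUC. Qed.

Let measurable_big_prod d' (Z : measurableType d') I (s : seq I) (A : pred I)
    (h : I -> Z -> R) :
  (forall i, A i -> measurable_fun setT (h i)) ->
  measurable_fun setT (fun z => \prod_(i <- s | A i) h i z).
Proof.
move=> mh.
apply: (big_closed (Q := fun f : Z -> R => measurable_fun setT f)) => //.
by move=> f g; exact: measurable_funM.
Qed.

Let measurable_big_sum d' (Z : measurableType d') I (s : seq I) (A : pred I)
    (h : I -> Z -> R) :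
  (forall i, A i -> measurable_fun setT (h i)) ->
  measurable_fun setT (fun z => \sum_(i <- s | A i) h i z).
Proof.
move=> mh.
apply: (big_closed (Q := fun f : Z -> R => measurable_fun setT f)) => //.
by move=> f g; exact: measurable_funD.
Qed.

Lemma graph_density_measurable k (F : graph k) (W : T * T -> R) :
  measurable_fun setT W -> coordinatewise_measurable (graph_density F W).
Proof.
move=> mW d' Z phi mphi.
have mWij i j : measurable_fun setT (fun z => W (phi z i, phi z j)).
  by apply: (measurableT_comp mW); exact: measurable_fun_pair.
apply: measurable_funM;
  apply: measurable_big_prod => i _; apply: measurable_big_prod => j _ //.
exact: measurable_funB.
Qed.

Let bounded (X : Type) (f : X -> R) := exists M : R, forall x, `|f x| <= M.

Let bounded_cst X (c : R) : bounded (fun _ : X => c).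
Proof. by exists `|c|. Qed.

Let boundedD X (f g : X -> R) : bounded f -> bounded g ->
  bounded (fun x => f x + g x).
Proof.
move=> [M fM] [N gN]; exists (M + N) => x.
by rewrite (le_trans (ler_normD _ _))// lerD.
Qed.

Let boundedM X (f g : X -> R) : bounded f -> bounded g ->
  bounded (fun x => f x * g x).
Proof.
by move=> [M fM] [N gN]; exists (M * N) => x; rewrite normrM ler_pM.
Qed.

Let bounded_prod (X I : Type) (s : seq I) (A : pred I) (h : I -> X -> R) :
  (forall i, A i -> bounded (h i)) ->
  bounded (fun x => \prod_(i <- s | A i) h i x).
Proof.
move=> bh; apply: (big_closed (Q := @bounded X)) => //; exact: boundedM.
Qed.

Let bounded_sum (X I : Type) (s : seq I) (A : pred I) (h : I -> X -> R) :
  (forall i, A i -> bounded (h i)) ->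
  bounded (fun x => \sum_(i <- s | A i) h i x).
Proof.
move=> bh; apply: (big_closed (Q := @bounded X)) => //; exact: boundedD.
Qed.

Lemma graph_density_bounded k (F : graph k) (W : T * T -> R) :
  bounded_fun W -> exists M, forall x, `|graph_density F W x| <= M.
Proof.
move=> /bounded_funP[M WM].
apply: boundedM; apply: bounded_prod => i _; apply: bounded_prod => j _.
  by exists M.
by exists (1 + M) => x; rewrite (le_trans (ler_normB _ _))// normr1 lerD2l.
Qed.

Lemma rooted_density_measurable k (F : graph k) a b (W : T * T -> R) :
  measurable_fun setT W -> measurable_fun setT (rooted_density F a b W).
Proof.
move=> mW; apply: (@iterated_integral_measurable _ _ _ _ _ _ _
  (graph_density_measurable F mW) _ _
  (fun z i => if i == a then z.1 else z.2)) => i.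
by case: (i == a); [exact: measurable_fst|exact: measurable_snd].
Qed.

Lemma rooted_density_bounded k (F : graph k) a b (W : T * T -> R) :
  measurable_fun setT W -> bounded_fun W ->
  exists M, forall z, `|rooted_density F a b W z| <= M.
Proof.
move=> mW /(graph_density_bounded F)[M FM]; exists M => z.
exact: iterated_integral_bounded (graph_density_measurable F mW) FM _.
Qed.

Lemma rooted_densityC k (F : graph k) a b W z : a != b ->
  rooted_density F b a W (z.2, z.1) = rooted_density F a b W z.
Proof.
move=> ab; rewrite /rooted_density.
under eq_filter do rewrite andbC.
apply: eq_iterated_integral => i /=.
rewrite !inE mem_filter mem_enum andbT negb_and !negbK => /orP[] /eqP ->.
  by rewrite eqxx (negbTE ab).
by rewrite eqxx eq_sym (negbTE ab).
Qed.

Lemma velocity_funC k (r : graph k -> graph k -> R) W z :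
  velocity_fun r W (z.2, z.1) = velocity_fun r W z.
Proof.
rewrite /velocity_fun; apply: eq_bigr => F _; apply: eq_bigr => H _.
congr (_ * _); under eq_bigr do rewrite big_mkcond.
rewrite exchange_big; apply: eq_bigr => a _ /=.
rewrite [RHS]big_mkcond; apply: eq_bigr => b _; rewrite eq_sym.
by case: ifPn => // ab; rewrite rooted_densityC// ![edge _ b a]edgeC.
Qed.

Lemma velocity_is_kernel_fun k (r : graph k -> graph k -> R) W :
  is_kernel_fun P W -> is_kernel_fun P (velocity_fun r W).
Proof.
move=> [mW bW _]; split.
- apply: measurable_big_sum => F _; apply: measurable_big_sum => H _.
  apply: measurable_funM => //.
  apply: measurable_big_sum => a _; apply: measurable_big_sum => b _.
  by apply: measurable_funM => //; exact: rooted_density_measurable.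
- apply/bounded_funP; rewrite -/(bounded _).
  apply: bounded_sum => F _; apply: bounded_sum => H _.
  apply: boundedM; first exact: bounded_cst.
  apply: bounded_sum => a _; apply: bounded_sum => b _.
  by apply: boundedM; [exact: rooted_density_bounded|exact: bounded_cst].
- by apply/nearW => z; rewrite velocity_funC.
Qed.

(* Fubini's theorem makes the class of velocity_fun r W depend only on the
   class of W, so the choice of the representative is immaterial. *)
Definition velocity k (r : graph k -> graph k -> R) (W : kernel_space P) :
    kernel_space P :=
  \pi_(kernel_space P)%qT (KernelFun
    (asboolT (velocity_is_kernel_fun r (kernel_funP (repr W))))).

Definition trajectory k (r : graph k -> graph k -> R) (W : kernel_space P)
    (I : set R) (Psi : R -> kernel_space P) :=
  [/\ open I, is_interval I, I 0, Psi 0 = W &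
      forall t, I t -> is_derive t 1 Psi (velocity r (Psi t))].

End Velocity.

(* Main.v *)
(** The velocity is Lipschitz on bounded sets of the Banach space of kernels,
    because each operator T_F^{a,b} is an iterated integral of a product of
    evaluations of the kernel and so depends only on its class.  For a bounded
    Lipschitz field F, the Euler scheme with steps 2^-n converges geometrically
    to a curve u with |u t - u s - (t - s) F (u s)| = O((t - s)^2), so no
    Banach-valued integral is needed; running it on a radial truncation of the
    velocity gives a trajectory whose lifetime depends only on the norm of the
    starting point.  Gronwall's lemma gives uniqueness, hence a maximal flow.
    On a graphon W the velocity lies between - N W and N (1 - W), since an edge
    can only be removed where it is present and added where it is absent;
    Euler steps shorter than 1 / N therefore preserve the set of graphons, which
    is the closed ball of radius 1/2 around the constant 1/2, and so does the
    forward flow. *)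
Require Import Defs.
From HB Require Import structures.
From mathcomp Require Import all_boot all_order all_algebra.
From mathcomp Require Import all_classical all_reals all_analysis.
From mathcomp Require Import measurable_realfun.
From mathcomp Require Import lra ring.

Set Implicit Arguments.
Unset Strict Implicit.
Unset Printing Implicit Defensive.
Import Order.TTheory GRing.Theory Num.Theory.
Import numFieldNormedType.Exports.
Local Open Scope classical_set_scope.
Local Open Scope ring_scope.

(** * Differential equations in Banach spaces *)

Section VectorValuedDerivative.
Context {R : realType} {E : normedModType R}.
Implicit Types (u v : R -> E) (t : R).

(** Clears the denominator of the difference quotient. At [s = t] the inequality is trivial, so the
    punctured neighbourhood becomes a full one. *)
Lemma is_derive_epsP u t (du : E) : is_derive t 1 u du <->
  forall e, 0 < e ->
    \forall s \near t, `|u s - u t - (s - t) *: du| <= e * `|s - t|.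
Proof.
pose q (h : R) := h^-1 *: ((u \o shift t) (h *: 1) - u t).
have quotE e h : h != 0 ->
    (`|u (h + t) - u t - h *: du| <= e * `|h|) = (`|du - q h| <= e).
  move=> h0; rewrite -[RHS](ler_pM2r (_ : 0 < `|h|)) ?normr_gt0//.
  rewrite [X in _ = (X <= _)]mulrC -normrZ scalerBr scalerA divff// scale1r.
  by rewrite distrC /= /GRing.scale/= mulr1.
have derE : is_derive t 1 u du <-> q h @[h --> 0^'] --> du.
  split=> [[dut <-]|qdu]; first exact: dut.
  apply: DeriveDef; first by apply/cvg_ex; exists du.
  exact: cvg_lim.
rewrite derE; split=> [/cvgrPdist_le qdu e e0|ud].
  rewrite (near_shift 0); have := qdu _ e0; rewrite near_withinE.
  apply: filterS => h /= hq; rewrite subr0 addrK.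
  have [->|h0] := eqVneq h 0; last by rewrite quotE// hq.
  by rewrite add0r subrr scale0r subr0 !normr0 mulr0.
apply/cvgrPdist_le => e e0; rewrite near_withinE.
have := ud _ e0; rewrite (near_shift 0); apply: filterS => h /=.
by rewrite subr0 addrK => hu h0; rewrite -quotE.
Qed.

Lemma is_derive_continuous u t du : is_derive t 1 u du -> {for t, continuous u}.
Proof.
move=> dut; apply/differentiable_continuous/derivable1_diffP; exact: ex_derive.
Qed.

(* Real induction on the claim |f s| <= e exp((L + 1) s) over [0, t]. *)
Lemma gronwall_eq0 (f df : R -> E) (L b : R) : 0 <= L ->
  (forall t, 0 <= t <= b -> is_derive t 1 f (df t)) ->
  (forall t, 0 <= t <= b -> `|df t| <= L * `|f t|) ->
  f 0 = 0 -> forall t, 0 <= t <= b -> f t = 0.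
Proof.
move=> L0 fdf dfL f0 b' /andP[b'0 b'b].
suff H e : 0 < e -> `|f b'| <= e * expR ((L + 1) * b').
  apply/eqP; rewrite -normr_le0; apply/ler_addgt0Pr => e e0; rewrite add0r.
  have := H (e / expR ((L + 1) * b')).
  by rewrite divr_gt0 ?expR_gt0// divfK ?gt_eqF ?expR_gt0//; exact.
(* The barrier grows at rate [L + 1] instead of [L]; the surplus [g c * (s - c)] will absorb the
   linearization error of [f] at [c]. *)
move=> e0; pose g t := e * expR ((L + 1) * t).
have g_gt0 t : 0 < g t by rewrite mulr_gt0 ?expR_gt0.
have gcont : continuous g.
  move=> t; apply: cvgM; first exact: cvg_cst.
  apply: continuous_comp; last exact: continuous_expR.
  by apply: cvgM; [exact: cvg_cst|exact: cvg_id].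
have gS t s : t <= s -> g t * (1 + (L + 1) * (s - t)) <= g s.
  move=> ts; rewrite /g (_ : (L + 1) * s = (L + 1) * t + (L + 1) * (s - t)).
    rewrite expRD -mulrA ler_wpM2l ?(ltW e0)// ler_wpM2l ?expR_ge0//.
    exact: expR_ge1Dx.
  by ring.
pose S := [set t | 0 <= t <= b' /\ forall s, 0 <= s <= t -> `|f s| <= g s].
have S0 : S 0.
  split=> [|s]; first by rewrite lexx.
  by rewrite -eq_le => /eqP <-; rewrite f0 normr0 ltW.
have Sub : ubound S b' by move=> t [/andP[]].
have hS : has_sup S by split; [exists 0|exists b'].
pose c := sup S.
have c0 : 0 <= c by apply: ub_le_sup => //; exists b'.
have cb' : c <= b' by apply: ge_sup => //; exists 0.
have ltc s : 0 <= s -> s < c -> `|f s| <= g s.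
  move=> s0 sc; have [t [_ St] st] := sup_gt hS.1 sc.
  by apply: St; rewrite s0 ltW.
have fc : {for c, continuous f}.
  by apply: is_derive_continuous (fdf c _); rewrite c0 (le_trans cb').
(* The supremum belongs to [S]: a strict violation at [c] would spread by continuity to some
   [m < c], where the bound is already known. *)
have Sc : S c.
  split=> [|s /andP[s0]]; first by rewrite c0.
  rewrite le_eqVlt => /orP[/eqP->|]; last exact: ltc.
  rewrite leNgt; apply/negP => gfc.
  have : \forall s \near c, g s < `|f s|.
    have /cvgr_gt : (`|f s| - g s) @[s --> c] --> `|f c| - g c.
      by apply: cvgB; [exact: cvg_norm|exact: gcont].
    move=> /(_ 0); rewrite subr_gt0 => /(_ gfc).
    by apply: filterS => z; rewrite subr_gt0.
  move=> /nbhs_ballP[d /= d0 dP].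
  have [c00|c_neq0] := eqVneq c 0.
    by move: gfc; rewrite c00 f0 normr0 ltNge (ltW (g_gt0 _)).
  have c_gt0 : 0 < c by rewrite lt_def c_neq0.
  pose m := Num.max 0 (c - d / 2).
  have mc : m < c by rewrite gt_max c_gt0/= gtrBl divr_gt0.
  have m0 : 0 <= m by rewrite le_max lexx.
  have := dP m; rewrite /ball/= gtr0_norm ?subr_gt0// => gf.
  have : m >= c - d / 2 by rewrite le_max lexx orbT.
  move=> mm; have /gf : c - m < d by lra.
  by rewrite ltNge ltc.
have [cb|] := ltP c b'; last first.
  move=> b'c; have <- : c = b' by apply/le_anti; rewrite cb'.
  by apply: Sc.2; rewrite c0 lexx.
exfalso.
have cin : 0 <= c <= b by rewrite c0 (le_trans cb').
(* With the tolerance [g c], the bound at [c] propagates to a right neighbourhood, so [c] would not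
   be the supremum. *)
have /is_derive_epsP/(_ _ (g_gt0 c)) := fdf c cin.
move=> /nbhs_ballP[d /= d0 dP].
pose m := Num.min b' (c + d / 2).
have cm : c < m by rewrite lt_min cb/= ltrDl divr_gt0.
have : S m.
  split=> [|s /andP[s0 sm]]; first by rewrite (le_trans c0 (ltW cm)) ge_min lexx.
  have [sc|cs] := leP s c; first by apply: Sc.2; rewrite s0.
  have ms : s <= c + d / 2 by rewrite (le_trans sm)// ge_min lexx orbT.
  have := dP s; rewrite /ball/= ltr0_norm ?subr_lt0// gtr0_norm ?subr_gt0//.
  have sd : - (c - s) < d by lra.
  move=> /(_ sd) fs; apply: le_trans (gS c s (ltW cs)).
  have fsE : `|f s| <= `|f c| + (s - c) * `|df c| + g c * (s - c).
    have n1 := ler_normD (f s - f c - (s - c) *: df c) (f c + (s - c) *: df c).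
    have n2 := ler_normD (f c) ((s - c) *: df c).
    move: n1; rewrite -[X in `|X + _|]addrA -opprD subrK => n1.
    move: n2; rewrite normrZ gtr0_norm ?subr_gt0// => n2.
    by move: fs n1 n2; clear => fs n1 n2; lra.
  have fcg : `|f c| <= g c by apply: Sc.2; rewrite c0 lexx.
  have sc0 : 0 <= s - c by rewrite subr_ge0 ltW.
  have dfg : (s - c) * `|df c| <= (s - c) * (L * g c).
    by rewrite ler_wpM2l// (le_trans (dfL _ cin))// ler_wpM2l.
  rewrite (le_trans fsE)//.
  have -> : g c * (1 + (L + 1) * (s - c)) = g c + (s - c) * (L * g c) + g c * (s - c).
    by ring.
  by rewrite lerD2r lerD.
by move=> /(ub_le_sup (ex_intro _ _ Sub)); rewrite leNgt cm.
Qed.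

End VectorValuedDerivative.

(** * Time reversal and uniqueness of solutions *)

Section Uniqueness.
Context {R : realType} {E : normedModType R}.
Implicit Types (u v : R -> E) (t : R) (G : E -> E).

Lemma is_derive_translate u t a du :
  is_derive (t + a) 1 u du -> is_derive t 1 (fun s => u (s + a)) du.
Proof.
move=> /is_derive_epsP ud; apply/is_derive_epsP => e /ud uad.
have sc : (s + a) @[s --> t] --> t + a.
  by apply: cvgD; [exact: cvg_id|exact: cvg_cst].
have : \forall s \near t, `|u (s + a) - u (t + a) - (s + a - (t + a)) *: du| <=
  e * `|s + a - (t + a)| by exact: (sc _ uad).
apply: filterS => s.
by rewrite opprD addrACA subrr addr0.
Qed.

(** Turns solutions for [G] at negative times into solutions for [- G] at positive times. *)
Lemma is_derive_reflect u t du :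
  is_derive (- t) 1 u du -> is_derive t 1 (u \o -%R) (- du).
Proof.
move=> /is_derive_epsP ud; apply/is_derive_epsP => e /ud uad.
have sc : - s @[s --> t] --> - t by apply: cvgN; exact: cvg_id.
have : \forall s \near t, `|u (- s) - u (- t) - (- s - - t) *: du| <=
  e * `|- s - - t| by exact: (sc _ uad).
apply: filterS => s /=.
by rewrite scalerN -scaleNr -opprD normrN.
Qed.

Lemma near_is_derive u v t du : (\forall s \near t, u s = v s) ->
  is_derive t 1 u du -> is_derive t 1 v du.
Proof.
move=> uv /is_derive_epsP ud; apply/is_derive_epsP => e /ud.
by rewrite (nbhs_singleton uv); apply: filterS2 uv => s ->.
Qed.

Definition bounded_lipschitz G := forall M, exists2 L, 0 <= L &
  forall x y, `|x| <= M -> `|y| <= M -> `|G x - G y| <= L * `|x - y|.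

Lemma bounded_lipschitzN G : bounded_lipschitz G -> bounded_lipschitz (-%R \o G).
Proof.
move=> lG M; have [L L0 GL] := lG M; exists L => // x y xM yM /=.
by rewrite -opprD normrN GL.
Qed.

Lemma continuous_segment_bounded u (a b : R) :
  (forall t, a <= t <= b -> {for t, continuous u}) ->
  exists M, forall t, a <= t <= b -> `|u t| <= M.
Proof.
move=> uc; have : bounded_set (u @` `[a, b]).
  apply/compact_bounded/continuous_compact; last exact: segment_compact.
  apply: continuous_in_subspaceT => t; rewrite inE/= in_itv/=; exact: uc.
move=> [M [_ uM]]; exists (M + 1) => t tab; apply: (uM (M + 1)).
  by rewrite ltrDl.
by exists t => //=; rewrite in_itv.
Qed.

(** Both solutions are bounded on the compact interval, so a single Lipschitz constant serves there
    and Gronwall's lemma applies to their difference. *)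
Lemma ode_unique_ge0 G u v b : bounded_lipschitz G ->
  (forall t, 0 <= t <= b -> is_derive t 1 u (G (u t))) ->
  (forall t, 0 <= t <= b -> is_derive t 1 v (G (v t))) ->
  u 0 = v 0 -> forall t, 0 <= t <= b -> u t = v t.
Proof.
move=> lG ud vd uv0 t tb.
have [M uM] : exists M, forall t, 0 <= t <= b -> `|u t| <= M.
  by apply: continuous_segment_bounded => s /ud; exact: is_derive_continuous.
have [N vN] : exists M, forall t, 0 <= t <= b -> `|v t| <= M.
  by apply: continuous_segment_bounded => s /vd; exact: is_derive_continuous.
have [L L0 GL] := lG (Num.max M N).
apply/eqP; rewrite -subr_eq0; apply/eqP.
apply: (@gronwall_eq0 _ _ (u - v) (fun s => G (u s) - G (v s)) L b) => //.
- move=> s sb; apply: is_deriveB; [exact: ud|exact: vd].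
- by move=> s sb; apply: GL; rewrite le_max ?uM ?vN ?orbT.
- by rewrite /GRing.add/= /GRing.opp/= uv0 subrr.
Qed.

Definition ode_solution G (x : E) (I : set R) u :=
  [/\ open I, is_interval I, I 0, u 0 = x &
      forall t, I t -> is_derive t 1 u (G (u t))].

Lemma ode_solution_unique G x I J u v : bounded_lipschitz G ->
  ode_solution G x I u -> ode_solution G x J v ->
  forall t, I t -> J t -> u t = v t.
Proof.
move=> lG [_ iI I0 u0 ud] [_ iJ J0 v0 vd] t It Jt.
have [t0|t0] := leP 0 t.
  apply: (@ode_unique_ge0 G u v t) => //; rewrite ?u0 ?lexx ?t0// => s s0t.
    by apply: ud; exact: iI s0t.
  by apply: vd; exact: iJ s0t.
have := @ode_unique_ge0 (-%R \o G) (u \o -%R) (v \o -%R) (- t).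
move=> /(_ (bounded_lipschitzN lG)) /=.
rewrite oppr0 u0 v0 => /(_ _ _ erefl (- t)); rewrite opprK lexx oppr_ge0 ltW//.
apply=> // s /andP[s0 st]; apply: is_derive_reflect.
  by apply/ud/(iI _ _ It I0); rewrite oppr_le0 s0 lerNr st.
by apply/vd/(iJ _ _ Jt J0); rewrite oppr_le0 s0 lerNr st.
Qed.

End Uniqueness.

(** * The Euler scheme on dyadic meshes *)

Section EulerScheme.
Context {R : realType} {E : normedModType R} (F : E -> E) (B L : R).
Context (FB : forall x, `|F x| <= B) (L_ge0 : 0 <= L)
  (FL : forall x y, `|F x - F y| <= L * `|x - y|).
Implicit Types (x y : E) (h t : R).

Let B_ge0 : 0 <= B. Proof. exact: le_trans (FB 0). Qed.

Definition euler h x i : E := iter i (fun y => y + h *: F y) x.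

Lemma eulerD h x i j : euler h x (i + j) = euler h (euler h x j) i.
Proof. exact: iterD. Qed.

Lemma euler_dist h x i : 0 <= h -> `|euler h x i - x| <= i%:R * h * B.
Proof.
move=> h0; elim: i => [|i IHi]; first by rewrite subrr normr0 !mul0r.
rewrite /= addrAC -natr1 !mulrDl mul1r (le_trans (ler_normD _ _))// lerD//.
by rewrite normrZ ger0_norm// ler_wpM2l.
Qed.

(** Replacing [F] at the current point by [F x] costs at most [h * L] times the distance to [x],
    which [euler_dist] controls; summing over the steps gives the square. *)
Lemma euler_linear h x i : 0 <= h ->
  `|euler h x i - x - (i%:R * h) *: F x| <= L * B * (i%:R * h) ^+ 2.
Proof.
move=> h0; elim: i => [|i IHi].
  by rewrite mul0r scale0r subr0 subrr normr0 expr0n mulr0.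
rewrite -natr1 mulrDl mul1r scalerDl /=.
set y := euler h x i in IHi *.
have -> : y + h *: F y - x - ((i%:R * h) *: F x + h *: F x) =
    (y - x - (i%:R * h) *: F x) + h *: (F y - F x).
  by rewrite scalerBr opprD addrA [y + _ - x]addrAC [X in X - _ = _]addrAC addrA.
apply: le_trans (ler_normD _ _) _; rewrite normrZ ger0_norm//.
have Fyx : h * `|F y - F x| <= h * (L * (i%:R * h * B)).
  by rewrite ler_wpM2l// (le_trans (FL _ _))// ler_wpM2l// euler_dist.
apply: le_trans (lerD IHi Fyx) _; rewrite -subr_ge0.
have -> : L * B * (i%:R * h + h) ^+ 2 -
  (L * B * (i%:R * h) ^+ 2 + h * (L * (i%:R * h * B))) =
  L * B * h ^+ 2 * (i%:R + 1) by ring.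
by rewrite !mulr_ge0// addr_ge0.
Qed.

(** Discrete Gronwall: two half steps differ from one full step by at most [h ^+ 2 * L * B], and a
    full step multiplies an earlier error by at most [1 + h * L]. *)
Lemma euler_halve h x i : 0 <= h ->
  `|euler (h / 2) x i.*2 - euler h x i| <=
    i%:R * (h ^+ 2 * L * B) * (1 + h * L) ^+ i.
Proof.
move=> h0; elim: i => [|i IHi]; first by rewrite subrr normr0 !mul0r.
rewrite doubleS /=; set y := euler (h / 2) x i.*2 in IHi *.
set z := euler h x i in IHi *.
(* The error splits into the propagated one, from [y - z], and the new defect of evaluating [F] at
   the midpoint instead of at [y]. *)
have -> : y + (h / 2) *: F y + (h / 2) *: F (y + (h / 2) *: F y) - (z + h *: F z) =
    (y - z) + h *: (F y - F z) + (h / 2) *: (F (y + (h / 2) *: F y) - F y).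
  have -> : h *: (F y - F z) = (h / 2) *: F y + (h / 2) *: F y - h *: F z.
    by rewrite -scalerDl -splitr scalerBr.
  rewrite scalerBr.
  move: ((h / 2) *: F y) ((h / 2) *: F (y + _)) (h *: F z) => a b c.
  rewrite -[a + a - c]addrA -[RHS]addrA [a + (a - c) + _]addrACA.
  by rewrite [a - c - a]addrAC subrr sub0r opprD -[y + a + b]addrA addrACA.
have half0 : 0 <= h / 2 by rewrite divr_ge0.
apply: le_trans (ler_normD _ _) _; rewrite normrZ (ger0_norm half0).
have FF : `|F (y + (h / 2) *: F y) - F y| <= L * (h / 2 * B).
  rewrite (le_trans (FL _ _))// ler_wpM2l// addrAC subrr add0r normrZ.
  by rewrite ger0_norm// ler_wpM2l.
have yz : `|y - z + h *: (F y - F z)| <= (1 + h * L) * `|y - z|.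
  rewrite (le_trans (ler_normD _ _))// mulrDl mul1r lerD2l normrZ ger0_norm//.
  by rewrite -mulrA ler_wpM2l.
have hL1 : 1 <= 1 + h * L by rewrite lerDl mulr_ge0.
have hL0 : 0 <= 1 + h * L by rewrite (le_trans _ hL1).
apply: (@le_trans _ _ ((1 + h * L) * (i%:R * (h ^+ 2 * L * B) * (1 + h * L) ^+ i) +
    (h ^+ 2 * L * B) * (1 + h * L) ^+ i.+1)).
  apply: lerD; first by rewrite (le_trans yz)// ler_wpM2l.
  apply: (@le_trans _ _ (h ^+ 2 * L * B)).
    apply: le_trans (ler_wpM2l half0 FF) _; rewrite -subr_ge0.
    have -> : h ^+ 2 * L * B - h / 2 * (L * (h / 2 * B)) =
      h ^+ 2 * L * B * (3 / 4) by field.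
    by rewrite !mulr_ge0// ?sqr_ge0// divr_ge0.
  by rewrite ler_peMr ?exprn_ege1// !mulr_ge0 ?sqr_ge0.
rewrite [(1 + h * L) ^+ i.+1]exprS -natr1 le_eqVlt; apply/orP; left; apply/eqP.
by move: ((1 + h * L) ^+ i) => p; ring.
Qed.

Definition mesh n : R := 2^-1 ^+ n.

Lemma mesh_gt0 n : 0 < mesh n. Proof. by rewrite exprn_gt0 ?invr_gt0. Qed.

Lemma meshS n : mesh n.+1 = mesh n / 2. Proof. by rewrite /mesh exprSr. Qed.

Lemma mesh_cvg0 : mesh n @[n --> \oo] --> 0.
Proof. by apply: cvg_expr; rewrite ger0_norm ?invr_ge0// invf_lt1// ltr1n. Qed.

Definition nsteps n t := Num.truncn (t / mesh n).

Lemma nsteps_itv n t : 0 <= t ->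
  (nsteps n t)%:R * mesh n <= t < (nsteps n t)%:R * mesh n + mesh n.
Proof.
move=> t0; rewrite -[X in _ < _ + X]mul1r -mulrDl natr1.
rewrite -ler_pdivlMr ?mesh_gt0// -ltr_pdivrMr ?mesh_gt0//.
by apply: truncn_itv; rewrite divr_ge0// ltW// mesh_gt0.
Qed.

(** After the full steps that fit into [t], the remainder is shorter than one step, so it has room
    for at most one half step. *)
Lemma nstepsS n t : 0 <= t -> exists b : bool,
  nsteps n.+1 t = (b + (nsteps n t).*2)%N.
Proof.
move=> t0; have /andP[] := nsteps_itv n t0; have /andP[] := nsteps_itv n.+1 t0.
move: (nsteps n t) (nsteps n.+1 t) (mesh_gt0 n) => i j s0.
rewrite meshS => jt tj it ti.
have ij : (i.*2 < j.+1)%N.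
  rewrite -(ltr_nat R) -muln2 natrM -natr1 -(ltr_pM2r s0).
  by have := le_lt_trans it tj => ?; lra.
have ji : (j < i.*2.+2)%N.
  rewrite -(ltr_nat R) -addn2 -muln2 natrD natrM -(ltr_pM2r s0).
  by have := le_lt_trans jt ti => ?; lra.
have [->|ne] := eqVneq j i.*2; first by exists false.
by exists true; apply/eqP; rewrite eqn_leq -ltnS ji/= ltn_neqAle eq_sym ne -ltnS.
Qed.

(** Piecewise constant in [t], without interpolation between grid points; the rounding shows up as
    the [mesh n] terms below. *)
Definition euler_approx x n t := euler (mesh n) x (nsteps n t).

(** The possible extra half step contributes at most [B * mesh n], and [euler_halve] the rest, with
    the power of [1 + mesh n * L] bounded by an exponential. Hence the increments decay
    geometrically. *)
Lemma euler_approxS x n t : 0 <= t ->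
  `|euler_approx x n.+1 t - euler_approx x n t| <=
    (B + t * L * B * expR (t * L)) * mesh n.
Proof.
move=> t0; rewrite /euler_approx; have [b ->] := nstepsS n t0.
have /andP[it _] := nsteps_itv n t0; move: (nsteps n t) it => i it.
have sn0 := ltW (mesh_gt0 n).
rewrite meshS eulerD -(subrKA (euler (mesh n / 2) x i.*2)).
apply: le_trans (ler_normD _ _) _; rewrite mulrDl lerD//.
  rewrite (le_trans (euler_dist _ _ _)) ?divr_ge0//.
  by rewrite [leRHS]mulrC ler_wpM2r//; case: (b) => /=; lra.
apply: le_trans (euler_halve _ _ sn0) _.
have -> : i%:R * (mesh n ^+ 2 * L * B) * (1 + mesh n * L) ^+ i =
  (i%:R * mesh n) * L * B * (1 + mesh n * L) ^+ i * mesh n by ring.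
rewrite ler_wpM2r//.
have p0 : 0 <= 1 + mesh n * L by rewrite addr_ge0 ?mulr_ge0.
apply: ler_pM; rewrite ?exprn_ge0 ?mulr_ge0//.
  by rewrite ler_wpM2r// ler_wpM2r.
apply: (@le_trans _ _ (expR (mesh n * L) ^+ i)).
  by rewrite lerXn2r ?nnegrE ?addr_ge0 ?mulr_ge0 ?expR_ge0 ?expR_ge1Dx.
by rewrite -expRM_natl ler_expR mulrA ler_wpM2r.
Qed.

(** By [eulerD], what happens between [s] and [t] is an Euler scheme of [k] steps started at the
    value at [s], and [k%:R * mesh n] is within [mesh n] of [t - s]. *)
Lemma euler_approx_lipschitz x n s t : 0 <= s -> s <= t ->
  `|euler_approx x n t - euler_approx x n s| <= B * (t - s + mesh n) /\
  `|euler_approx x n t - euler_approx x n s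
     - (t - s) *: F (euler_approx x n s)| <=
    L * B * (t - s + mesh n) ^+ 2 + B * mesh n.
Proof.
move=> s0 st; rewrite /euler_approx.
have /andP[js sj] := nsteps_itv n s0.
have /andP[it ti] := nsteps_itv n (le_trans s0 st).
have sn0 := ltW (mesh_gt0 n).
have ji : (nsteps n s <= nsteps n t)%N.
  by apply: le_truncn; rewrite ler_pM2r ?invr_gt0 ?mesh_gt0.
rewrite -(subnK ji) in it ti *; move: it ti; rewrite natrD mulrDl eulerD.
move: (nsteps n s) (nsteps n t - nsteps n s)%N js sj => j k js sj it ti.
set y := euler _ x j.
have ks : k%:R * mesh n <= t - s + mesh n by lra.
have ks0 : 0 <= k%:R * mesh n by rewrite mulr_ge0.
split.
  by rewrite (le_trans (euler_dist _ _ _))// mulrC ler_wpM2l.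
rewrite -(subrKA ((k%:R * mesh n) *: F y)).
rewrite (le_trans (ler_normD _ _))// lerD//.
  rewrite (le_trans (euler_linear _ _ _))// ler_wpM2l ?mulr_ge0//.
  by rewrite lerXn2r ?nnegrE// (le_trans ks0).
rewrite -scalerBl normrZ mulrC ler_pM// ler_norml; lra.
Qed.

Lemma euler_approx_ball x c rho h0 : 0 < h0 ->
  (forall h y, 0 <= h <= h0 -> `|y - c| <= rho -> `|y + h *: F y - c| <= rho) ->
  `|x - c| <= rho ->
  \forall n \near \oo, forall t, `|euler_approx x n t - c| <= rho.
Proof.
move=> h0_gt0 stepP xc.
have : \forall n \near \oo, mesh n <= h0 by exact: (cvgr_le 0 mesh_cvg0).
apply: filterS => n sn t.
rewrite /euler_approx; elim: (nsteps n t) => //= i IHi.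
by apply: stepP => //; rewrite sn ltW// mesh_gt0.
Qed.

Lemma lipschitz_continuous : continuous F.
Proof.
move=> y; apply/cvgrPdist_le => e e0.
have L1 : 0 < L + 1 by rewrite ltr_wpDl.
have d0 : 0 < e / (L + 1) by rewrite divr_gt0.
have : \forall z \near y, `|y - z| <= e / (L + 1).
  by have /cvgr_dist_le := @cvg_id _ (nbhs y); exact.
apply: filterS => z yz; rewrite (le_trans (FL _ _))//.
rewrite (@le_trans _ _ ((L + 1) * (e / (L + 1))))//.
  by apply: ler_pM => //; rewrite lerDl.
by rewrite mulrC divfK// gt_eqF.
Qed.

End EulerScheme.

(** The telescoping series is dominated in norm by a geometric one, so it converges by
    completeness. *)
Lemma geometric_increments_cvg {R : realType} {E : completeNormedModType R}
    (a : nat -> E) (C : R) :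
  (forall n, `|a n.+1 - a n| <= C * mesh n) -> cvgn a.
Proof.
move=> aC; have : cvgn (series (telescope a)).
  apply: normed_cvg.
  apply: (@series_le_cvg _ _ (geometric C 2^-1)) => [n|n|n|].
  - exact: normr_ge0.
  - exact: le_trans (normr_ge0 _) (aC n).
  - exact: aC.
  - apply: is_cvg_geometric_series.
    by rewrite ger0_norm ?invr_ge0// invf_lt1// ltr1n.
move=> /cvg_ex[l sl]; apply/cvg_ex; exists (a 0 + l).
have aE : a = (fun n => a 0%N + series (telescope a) n).
  by apply/funext => n; exact: eq_sum_telescope.
suff : (a 0%N + series (telescope a) n) @[n --> \oo] --> a 0%N + l by rewrite -aE.
by apply: cvgD => //; exact: cvg_cst.
Qed.

(** * The limit of the Euler scheme at nonnegative times *)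

Section EulerLimit.
Context {R : realType} {E : completeNormedModType R} (F : E -> E) (B L : R).
Context (FB : forall x, `|F x| <= B) (L_ge0 : 0 <= L)
  (FL : forall x y, `|F x - F y| <= L * `|x - y|).
Implicit Types (x : E) (s t : R).

Definition euler_limit x t : E := lim (euler_approx F x n t @[n --> \oo]).

Lemma euler_approx_cvg x t : 0 <= t ->
  euler_approx F x n t @[n --> \oo] --> euler_limit x t.
Proof.
move=> t0; apply: (geometric_increments_cvg
  (C := B + t * L * B * expR (t * L))) => n.
exact: euler_approxS.
Qed.

Lemma euler_limit0 x : euler_limit x 0 = x.
Proof.
apply: cvg_lim => //; rewrite (_ : (fun n => _) = cst x); first exact: cvg_cst.
by apply/funext => n; rewrite /euler_approx /nsteps mul0r truncn0.
Qed.

Let mesh_affine_cvg (a b : R) : a * mesh n + b @[n --> \oo] --> b.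
Proof.
rewrite -[X in _ --> X]add0r -[X in X + _](mulr0 a).
by apply: cvgD; [apply: cvgM; [exact: cvg_cst|exact: mesh_cvg0]|exact: cvg_cst].
Qed.

Lemma euler_limit_lipschitz x s t : 0 <= s -> s <= t ->
  `|euler_limit x t - euler_limit x s| <= B * (t - s).
Proof.
move=> s0 st; apply: (@ler_cvg_to _ (\oo) _ _
  (fun n => `|euler_approx F x n t - euler_approx F x n s|)
  (fun n => B * (t - s + mesh n))).
- by apply: cvg_norm; apply: cvgB; apply: euler_approx_cvg;
    rewrite ?(le_trans s0).
- under eq_fun do rewrite mulrDr addrC; exact: mesh_affine_cvg.
- by near=> n; have [] := euler_approx_lipschitz FB L_ge0 FL x n s0 st.
Unshelve. all: by end_near. Qed.

Lemma euler_limit_linear x s t : 0 <= s -> s <= t ->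
  `|euler_limit x t - euler_limit x s - (t - s) *: F (euler_limit x s)| <=
    L * B * (t - s) ^+ 2.
Proof.
move=> s0 st; apply: (@ler_cvg_to _ (\oo) _ _
  (fun n => `|euler_approx F x n t - euler_approx F x n s
    - (t - s) *: F (euler_approx F x n s)|)
  (fun n => L * B * (t - s + mesh n) ^+ 2 + B * mesh n)).
- have as_cvg := @euler_approx_cvg x _ s0.
  apply: cvg_norm; apply: cvgB.
    by apply: cvgB => //; apply: euler_approx_cvg; rewrite (le_trans s0).
  apply: cvgZ; first exact: cvg_cst.
  by apply: continuous_cvg => //; exact: (lipschitz_continuous L_ge0 FL).
- have qs : (t - s + mesh n) @[n --> \oo] --> t - s.
    rewrite -[X in _ --> X]addr0.
    by apply: cvgD; [exact: cvg_cst|exact: mesh_cvg0].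
  have -> : L * B * (t - s) ^+ 2 = L * B * ((t - s) * (t - s)) + B * 0.
    by rewrite mulr0 addr0 expr2.
  under eq_fun do rewrite expr2.
  apply: cvgD; apply: cvgM; [exact: cvg_cst|exact: cvgM|exact: cvg_cst|].
  exact: mesh_cvg0.
- by near=> n; have [] := euler_approx_lipschitz FB L_ge0 FL x n s0 st.
Unshelve. all: by end_near. Qed.

Lemma euler_limit_ball x c rho h0 : 0 < h0 ->
  (forall h y, 0 <= h <= h0 -> `|y - c| <= rho -> `|y + h *: F y - c| <= rho) ->
  `|x - c| <= rho -> forall t, 0 <= t -> `|euler_limit x t - c| <= rho.
Proof.
move=> h0_gt0 stepP xc t t0; apply: (@ler_cvg_to _ (\oo) _ _
  (fun n => `|euler_approx F x n t - c|) (cst rho)).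
- by apply: cvg_norm; apply: cvgB; [exact: euler_approx_cvg|exact: cvg_cst].
- exact: cvg_cst.
- have := euler_approx_ball h0_gt0 stepP xc; exact: filterS.
Qed.

End EulerLimit.

Section GlobalSolution.
Context {R : realType} {E : completeNormedModType R} (F : E -> E) (B L : R).
Context (FB : forall x, `|F x| <= B) (L_ge0 : 0 <= L)
  (FL : forall x y, `|F x - F y| <= L * `|x - y|).
Implicit Types (x : E) (s t : R).

Let B_ge0 : 0 <= B. Proof. exact: le_trans (FB 0). Qed.

Lemma quadratic_is_derive (u : R -> E) (t : R) (du : E) (C : R) : 0 <= C ->
  (forall s, `|u s - u t - (s - t) *: du| <= C * `|s - t| ^+ 2) ->
  is_derive t 1 u du.
Proof.
move=> C0 uC; apply/is_derive_epsP => e e0.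
have C1 : 0 < C + 1 by rewrite ltr_wpDl.
have d0 : 0 < e / (C + 1) by rewrite divr_gt0.
have : \forall s \near t, `|t - s| <= e / (C + 1).
  by have /cvgr_dist_le := @cvg_id _ (nbhs t); exact.
apply: filterS => s; rewrite distrC => st; apply: le_trans (uC s) _.
rewrite expr2 mulrA ler_wpM2r//.
rewrite (@le_trans _ _ ((C + 1) * (e / (C + 1))))//.
  by apply: ler_pM => //; rewrite lerDl.
by rewrite mulrC divfK// gt_eqF.
Qed.

Lemma euler_limit_dist x s t : 0 <= s -> 0 <= t ->
  `|euler_limit F x t - euler_limit F x s| <= B * `|t - s|.
Proof.
move=> s0 t0; have [st|/ltW ts] := leP s t.
  by rewrite [`|t - s|]ger0_norm ?subr_ge0// (euler_limit_lipschitz FB L_ge0 FL).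
rewrite distrC [`|t - s|]distrC [`|s - t|]ger0_norm ?subr_ge0//.
exact: (euler_limit_lipschitz FB L_ge0 FL).
Qed.

Lemma euler_limit_taylor x s t : 0 <= s -> 0 <= t ->
  `|euler_limit F x t - euler_limit F x s - (t - s) *: F (euler_limit F x s)|
    <= 2 * L * B * `|t - s| ^+ 2.
Proof.
move=> s0 t0; have LB := mulr_ge0 L_ge0 B_ge0.
have [st|/ltW ts] := leP s t.
  rewrite [`|t - s|]ger0_norm ?subr_ge0//.
  rewrite (le_trans (euler_limit_linear FB L_ge0 FL x s0 st))//.
  by rewrite ler_wpM2r ?sqr_ge0// -mulrA ler_peMl// ler1n.
(* For [t] before [s] the expansion is available only around [t]. Moving the base point of [F] to
   [s] costs another [L * B * (s - t) ^+ 2], whence the factor 2. *)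
have := euler_limit_linear FB L_ge0 FL x t0 ts.
have := euler_limit_dist x s0 t0.
rewrite [`|t - s|]distrC [`|s - t|]ger0_norm ?subr_ge0//.
set a := euler_limit F x t; set b := euler_limit F x s => ab bat.
have -> : a - b - (t - s) *: F b =
    - (b - a - (s - t) *: F a) - (s - t) *: (F a - F b).
  rewrite scalerBr -[t - s]opprB scaleNr opprK !opprB.
  by rewrite [_ + (a - b)]addrC -[RHS]addrA [X in _ = _ + X]addrC subrK.
apply: le_trans (ler_normB _ _) _; rewrite normrN.
rewrite normrZ [`|s - t|]ger0_norm ?subr_ge0//.
have FF : (s - t) * `|F a - F b| <= (s - t) * (L * (B * (s - t))).
  by rewrite ler_wpM2l ?subr_ge0// (le_trans (FL _ _))// ler_wpM2l.
apply: le_trans (lerD bat FF) _.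
by rewrite le_eqVlt; apply/orP; left; apply/eqP; ring.
Qed.

End GlobalSolution.

(** * Two-sided solutions for a bounded Lipschitz field *)

Section Glue.
Context {R : realType} {E : completeNormedModType R} (F : E -> E) (B L : R).
Context (FB : forall x, `|F x| <= B) (L_ge0 : 0 <= L)
  (FL : forall x y, `|F x - F y| <= L * `|x - y|).
Implicit Types (x : E) (s t : R).

Let B_ge0 : 0 <= B. Proof. exact: le_trans (FB 0). Qed.

Definition global_solution x t :=
  if 0 <= t then euler_limit F x t else euler_limit (-%R \o F) x (- t).

Local Notation u := global_solution.

Lemma global_solution0 x : u x 0 = x.
Proof. by rewrite /u lexx euler_limit0. Qed.

Lemma global_solution_neg x t : t <= 0 ->
  u x t = euler_limit (-%R \o F) x (- t).
Proof.
rewrite le_eqVlt => /orP[/eqP ->|t0]; last by rewrite /u leNgt t0.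
by rewrite global_solution0 oppr0 euler_limit0.
Qed.

Let NFB y : `|(-%R \o F) y| <= B. Proof. by rewrite /= normrN. Qed.

Let NFL y z : `|(-%R \o F) y - (-%R \o F) z| <= L * `|y - z|.
Proof. by rewrite /= -opprD normrN. Qed.

Let same_sign x s t : (0 <= s) && (0 <= t) || (s <= 0) && (t <= 0) ->
  `|u x t - u x s| <= B * `|t - s| /\
  `|u x t - u x s - (t - s) *: F (u x s)| <= 2 * L * B * `|t - s| ^+ 2.
Proof.
move=> /orP[] /andP[s0 t0].
  rewrite /u s0 t0; split; first exact: (euler_limit_dist FB L_ge0 FL).
  exact: (euler_limit_taylor FB L_ge0 FL).
rewrite !global_solution_neg//; move: s0 t0; rewrite -2!oppr_ge0 => s0 t0.
have tsE : `|t - s| = `|- t - - s| by rewrite -opprD normrN.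
rewrite tsE; split; first exact: (euler_limit_dist NFB L_ge0 NFL).
have := euler_limit_taylor NFB L_ge0 NFL x s0 t0.
by rewrite /= scalerN -scaleNr opprD !opprK.
Qed.

Lemma global_solution_dist0 x t : `|u x t - x| <= B * `|t|.
Proof.
have [] := @same_sign x 0 t; first by rewrite lexx; exact: le_total.
by rewrite global_solution0 subr0.
Qed.

Lemma global_solution_is_derive x t : is_derive t 1 (u x) (F (u x t)).
Proof.
have LB := mulr_ge0 L_ge0 B_ge0.
apply: (@quadratic_is_derive _ _ _ _ _ (2 * L * B)).
  by rewrite -mulrA mulr_ge0.
move=> s; have [ss|] := boolP ((0 <= t) && (0 <= s) || (t <= 0) && (s <= 0)).
  by have [] := same_sign x ss.
move=> ns.
have s0 : (0 <= 0 :> R) && (0 <= s) || (0 <= 0 :> R) && (s <= 0).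
  by rewrite lexx /=; exact: le_total.
have t0 : (0 <= t) && (0 <= 0 :> R) || (t <= 0) && (0 <= 0 :> R).
  by rewrite lexx !andbT; exact: le_total.
have [_ us] := same_sign x s0; have [ut utq] := same_sign x t0.
(* For opposite signs the expansion passes through time [0]. Since the distances add up, the square
   of the sum has room for the cross term that comes from comparing [F] at times [0] and [t]. *)
have stE : `|s - t| = `|s| + `|t|.
  move: ns; case: (ltrgtP t 0) => tn; case: (ltrgtP s 0) => sn //= _.
    by rewrite (ltr0_norm tn) (gtr0_norm sn) gtr0_norm// subr_gt0 (lt_trans tn).
  rewrite (ltr0_norm sn) (gtr0_norm tn) ltr0_norm; last first.
    by rewrite subr_lt0 (lt_trans sn).
  by rewrite opprB addrC.
rewrite stE; move: us ut utq; rewrite !(subr0, sub0r).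
set a := u x s; set b := u x t; set c := u x 0 => us ut utq.
have -> : a - b - (s - t) *: F b =
    (a - c - s *: F c) + (c - b - (- t) *: F b) + s *: (F c - F b).
  rewrite scalerBl scaleNr opprK scalerBr opprB.
  move: (s *: F c) (s *: F b) (t *: F b) => p q r.
  by rewrite [X in _ = X + _]addrACA subrKA [- p + r]addrC -[RHS]addrA subrKA.
have sFF : `|s *: (F c - F b)| <= `|s| * (L * (B * `|t|)).
  rewrite normrZ ler_wpM2l// (le_trans (FL _ _))// ler_wpM2l//.
  by rewrite -(normrN t).
apply: le_trans (ler_normD _ _) _; apply: le_trans (lerD (ler_normD _ _) sFF) _.
apply: le_trans (lerD (lerD us utq) (lexx _)) _; rewrite normrN -subr_ge0.
have -> : 2 * L * B * (`|s| + `|t|) ^+ 2 -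
   (2 * L * B * `|s| ^+ 2 + 2 * L * B * `|t| ^+ 2 + `|s| * (L * (B * `|t|))) =
  3 * (L * B) * `|s| * `|t| by ring.
by rewrite !mulr_ge0.
Qed.

Lemma global_solution_ball x c rho h0 : 0 < h0 ->
  (forall h y, 0 <= h <= h0 -> `|y - c| <= rho -> `|y + h *: F y - c| <= rho) ->
  `|x - c| <= rho -> forall t, 0 <= t -> `|u x t - c| <= rho.
Proof.
move=> h0_gt0 Fball xc t t0; rewrite /u t0.
exact: (euler_limit_ball FB L_ge0 FL h0_gt0).
Qed.

End Glue.

(** * Radial truncation in a normed space *)

Section RadialRetraction.
Context {R : realType} {E : normedModType R}.
Implicit Types (x y : E) (M : R).

Definition radial M x := if `|x| <= M then x else (M / `|x|) *: x.

Lemma radial_id M x : `|x| <= M -> radial M x = x.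
Proof. by rewrite /radial => ->. Qed.

Lemma norm_radial M x : 0 <= M -> `|radial M x| <= M.
Proof.
move=> M0; rewrite /radial; case: ifPn => //; rewrite -ltNge => Mx.
have x0 : 0 < `|x| by exact: le_lt_trans Mx.
by rewrite normrZ normrM normfV normr_id ger0_norm// divfK// gt_eqF.
Qed.

(** When both points are outside the ball, the comparison goes through [(M / |x|) *: y]: scaling
    both points by one factor below 1, then changing the factor, each costs at most [|x - y|]. Hence
    the 2, where a Hilbert norm would give 1. *)
Lemma radial_lipschitz M x y : 0 <= M ->
  `|radial M x - radial M y| <= 2 * `|x - y|.
Proof.
move=> M0; wlog xy : x y / `|x| <= `|y|.
  move=> wh; have [/wh//|/ltW/wh] := leP `|x| `|y|.
  by rewrite distrC [`|y - x|]distrC.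
have dxy : `|y| - `|x| <= `|x - y|.
  by rewrite distrC; exact: lerB_dist.
rewrite /radial; case: ifPn => [xM|]; last rewrite -ltNge => Mx.
  case: ifPn => [yM|]; first by rewrite ler_peMl// ler1n.
  rewrite -ltNge => My; have y0 : 0 < `|y| by exact: le_lt_trans My.
  rewrite -(subrKA y) (le_trans (ler_normD _ _))//.
  rewrite -[X in _ + `|X - _|]scale1r -scalerBl normrZ.
  have -> : `|1 - M / `|y| | * `|y| = `|y| - M.
    rewrite ger0_norm; first by rewrite mulrBl mul1r divfK// gt_eqF.
    by rewrite subr_ge0 ler_pdivrMr// mul1r ltW.
  by lra.
have x0 : 0 < `|x| by exact: le_lt_trans Mx.
have y0 : 0 < `|y| by exact: lt_le_trans xy.
rewrite [`|y| <= M]leNgt (lt_le_trans Mx xy)/=.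
have Mx1 : M / `|x| <= 1 by rewrite ler_pdivrMr// mul1r ltW.
have Mx0 : 0 <= M / `|x| by rewrite divr_ge0.
rewrite -(subrKA ((M / `|x|) *: y)) -scalerBr -scalerBl.
apply: le_trans (ler_normD _ _) _; rewrite [`|_ *: (x - y)|]normrZ.
rewrite [`|_ *: y|]normrZ (ger0_norm Mx0).
have -> : `|M / `|x| - M / `|y| | * `|y| = M / `|x| * (`|y| - `|x|).
  rewrite ger0_norm; last by rewrite subr_ge0 ler_wpM2l// lef_pV2.
  by field; rewrite !gt_eqF.
rewrite -mulrDr (le_trans (ler_piMl _ Mx1))//; last by lra.
by rewrite addr_ge0// subr_ge0.
Qed.

End RadialRetraction.

Section LocalExistence.
Context {R : realType} {E : completeNormedModType R} (G : E -> E).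
Context (G_lip : bounded_lipschitz G).
Implicit Types (x y c : E) (t rho : R).

(* The Euler scheme is run on the radial truncation of [G], which coincides
   with [G] on the ball of radius [M + 1]. *)
Lemma ode_exists M : 0 <= M ->
  exists2 delta : R, 0 < delta & exists u : E -> R -> E,
  [/\ forall x, `|x| <= M -> ode_solution G x `]-delta, delta[ (u x) &
      forall x c rho h0, 0 < h0 ->
        (forall y, `|y - c| <= rho -> `|y| <= M) ->
        (forall h y, 0 <= h <= h0 -> `|y - c| <= rho ->
          `|y + h *: G y - c| <= rho) ->
        `|x - c| <= rho ->
        ode_solution G x `]-delta, +oo[ (u x) /\
        forall t, 0 <= t -> `|u x t - c| <= rho].
Proof.
move=> M0; have M1 : 0 <= M + 1 by rewrite addr_ge0.
have [L0 L00 GL] := G_lip (M + 1).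
pose F := G \o radial (M + 1).
pose B := `|G 0| + L0 * (M + 1).
pose L := L0 * 2.
have FB x : `|F x| <= B.
  rewrite -[F x](subrK (G 0)) (le_trans (ler_normD _ _))// [leRHS]addrC lerD2r.
  rewrite (le_trans (GL _ _ _ _)) ?normr0 ?norm_radial// subr0.
  by rewrite ler_wpM2l ?norm_radial.
have L_ge0 : 0 <= L by rewrite mulr_ge0.
have FL x y : `|F x - F y| <= L * `|x - y|.
  rewrite (le_trans (GL _ _ _ _)) ?norm_radial// -mulrA ler_wpM2l//.
  exact: radial_lipschitz.
have FE y : `|y| <= M + 1 -> F y = G y by move=> yM; rewrite /F/= radial_id.
have B0 : 0 <= B by rewrite addr_ge0// mulr_ge0.
have B1 : 0 < B + 1 by rewrite ltr_wpDl.
have d0 : 0 < (B + 1)^-1 by rewrite invr_gt0.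
pose u := global_solution F.
(* At speed at most [B], a curve travels less than 1 in a time below [1 / (B + 1)], so it stays
   where the truncation agrees with [G]. *)
have near0 x t : `|x| <= M -> `|t| < (B + 1)^-1 -> `|u x t| <= M + 1.
  move=> xM td; rewrite -[u x t](subrK x) (le_trans (ler_normD _ _))//.
  rewrite addrC lerD// (le_trans (global_solution_dist0 FB L_ge0 FL x t))//.
  rewrite (@le_trans _ _ ((B + 1) * (B + 1)^-1))//; last first.
    by rewrite divff// gt_eqF.
  by apply: ler_pM => //; [rewrite lerDl|exact: ltW].
have ud x t : `|u x t| <= M + 1 -> is_derive t 1 (u x) (G (u x t)).
  by move=> uM; rewrite -FE//; exact: (global_solution_is_derive FB L_ge0 FL).
exists (B + 1)^-1 => //; exists u; split=> [x xM|x c rho h0 h0_gt0 cM stepP xc].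
  split.
  - exact: interval_open.
  - exact: interval_is_interval.
  - by rewrite /= in_itv/= oppr_lt0 d0.
  - exact: global_solution0.
  - move=> t; rewrite /= in_itv/= => td.
    by apply/ud/near0 => //; rewrite ltr_norml.
(* The invariant ball lies in the ball of radius [M], so the truncation is never felt at positive
   times and the solution extends to infinity. *)
have u_ball t : 0 <= t -> `|u x t - c| <= rho.
  move=> t0; apply: (global_solution_ball FB L_ge0 FL h0_gt0 _ xc t0) => h y hh yc.
  by rewrite FE ?stepP// (le_trans (cM _ yc))// lerDl.
split=> //; split.
- exact: interval_open.
- exact: interval_is_interval.
- by rewrite /= in_itv/= andbT oppr_lt0 d0.
- exact: global_solution0.
- move=> t; rewrite /= in_itv/= andbT => td; apply: ud.
  have [t0|t0] := leP 0 t.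
    by rewrite (le_trans (cM _ (u_ball _ t0)))// lerDl.
  by apply: near0; [exact: cM|rewrite ltr0_norm// ltrNl].
Qed.

End LocalExistence.

(** * The maximal flow and its invariant balls *)

Section MaximalFlow.
Context {R : realType} {E : completeNormedModType R} (G : E -> E).
Context (G_lip : bounded_lipschitz G).
Implicit Types (x y c : E) (s t rho : R) (I : set R) (u : R -> E).

Definition max_domain x : set R :=
  [set t | exists I u, ode_solution G x I u /\ I t].

(** By uniqueness the choice of solution is immaterial on [max_domain x]; outside it the value is
    the default [0]. *)
Definition max_flow x t : E :=
  xget 0 [set y | exists I u, [/\ ode_solution G x I u, I t & u t = y]].

Lemma max_flowE x I u t : ode_solution G x I u -> I t -> max_flow x t = u t.
Proof.
move=> uI It; rewrite /max_flow; case: xgetP => [y _|/(_ (u t))].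
  by move=> [J [v [vJ Jt <-]]]; exact: ode_solution_unique vJ uI _ Jt It.
by case; exists I, u.
Qed.

Lemma max_flow_solution x : ode_solution G x (max_domain x) (max_flow x).
Proof.
have [d d0 [u [/(_ x (lexx _)) uI _]]] := ode_exists G_lip (normr_ge0 x).
have [_ _ I0 u0 _] := uI; split.
- rewrite openE => t [I [v [vI It]]]; have [oI _ _ _ _] := vI.
  have : nbhs t I by exact: open_nbhs_nbhs.
  by apply: filterS => s Is; exists I, v.
(* All domains contain [0], so a point between [s] and [t] lies between [0] and one of them, hence
   inside a single domain. *)
- move=> s t [I [v [vI Is]]] [J [w [wJ Jt]]] z /andP[sz zt].
  have [_ iI I00 _ _] := vI; have [_ iJ J00 _ _] := wJ.
  have [z0|z0] := leP 0 z; first last.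
    by exists I, v; split => //; apply: (iI _ _ Is I00); rewrite sz ltW.
  by exists J, w; split => //; apply: (iJ _ _ J00 Jt); rewrite z0.
- by exists [set` `]-d, d[], (u x).
- by rewrite (max_flowE uI).
- move=> t [I [v [vI It]]]; have [oI _ _ _ vd] := vI.
  rewrite (max_flowE vI It); apply: near_is_derive (vd t It).
  have : nbhs t I by exact: open_nbhs_nbhs.
  by apply: filterS => s Is; rewrite (max_flowE vI).
Qed.

Lemma ode_solution_shift x I u s : ode_solution G x I u -> I s ->
  ode_solution G (u s) [set t | I (t + s)] (fun t => u (t + s)).
Proof.
move=> [oI iI I0 u0 ud] Is; split.
- apply: open_comp => // t _.
  by apply: cvgD; [exact: cvg_id|exact: cvg_cst].
- move=> a b /= Ia Ib z /andP[az zb].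
  by apply: (iI _ _ Ia Ib); rewrite !lerD2r az.
- by rewrite /= add0r.
- by rewrite add0r.
- by move=> t It; exact/is_derive_translate/ud.
Qed.

Lemma max_domain_sub x s : max_domain x s ->
  [set t | max_domain x (t + s)] `<=` max_domain (max_flow x s) /\
  forall t, max_domain x (t + s) ->
    max_flow (max_flow x s) t = max_flow x (t + s).
Proof.
move=> Ds; have sol := ode_solution_shift (max_flow_solution x) Ds; split.
  by move=> t Dts; exists [set t | max_domain x (t + s)], (fun t => max_flow x (t + s)).
by move=> t Dts; rewrite (max_flowE sol).
Qed.

(** The inclusion missing from [max_domain_sub] is the same lemma applied at time [- s], which
    carries [max_flow x s] back to [x]. *)
Lemma max_domain_flow x s : max_domain x s ->
  max_domain (max_flow x s) = [set t | max_domain x (t + s)].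
Proof.
move=> Ds; have [DD Dflow] := max_domain_sub Ds.
apply/seteqP; split=> // t Dt.
have [_ _ D0 Phi0 _] := max_flow_solution x.
have DNs : max_domain (max_flow x s) (- s) by apply: DD; rewrite /= addNr.
have [+ _] := max_domain_sub DNs.
by rewrite Dflow addNr// Phi0 => /(_ (t + s)); apply; rewrite /= addrK.
Qed.

(** Points of the ball live forever forward, inside the ball, and for a common time [d] backward.
    Forward invariance makes [I] closed upwards. A limit [t] of times in [I] is within [d] of one of
    them, so [t] is in the domain, and continuity puts the flow at [t] in the ball; thus [I] is
    closed in the whole line. *)
Lemma max_flow_ball c rho h0 x : 0 < h0 ->
  (forall h y, 0 <= h <= h0 -> `|y - c| <= rho ->
    `|y + h *: G y - c| <= rho) ->
  `|x - c| <= rho ->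
  let I := [set t | max_domain x t /\ `|max_flow x t - c| <= rho] in
  [/\ closed I, is_interval I & `[0, +oo[ `<=` I].
Proof.
move=> h0_gt0 stepP xc I.
have cM y : `|y - c| <= rho -> `|y| <= rho + `|c|.
  by move=> yc; rewrite -[y](subrK c) (le_trans (ler_normD _ _))// lerD2r.
have M0 : 0 <= rho + `|c| by rewrite addr_ge0// (le_trans _ xc).
have [d d0 [u [_ /(_ _ c rho h0 h0_gt0 cM stepP) uP]]] := ode_exists G_lip M0.
have forward y t : `|y - c| <= rho -> - d < t ->
    max_domain y t /\ (0 <= t -> `|max_flow y t - c| <= rho).
  move=> /uP[uy ub] dt.
  have It : [set` `]-d, +oo[] t by rewrite /= in_itv/= dt.
  by split; [exists [set` `]-d, +oo[], (u y)|move=> t0; rewrite (max_flowE uy It) ub].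
have up s t : I s -> s <= t -> I t.
  move=> [Ds sc] st; have ts0 : 0 <= t - s by rewrite subr_ge0.
  have [] := forward _ (t - s) sc; first by rewrite (lt_le_trans _ ts0)// oppr_lt0.
  rewrite max_domain_flow// => /= + /(_ ts0); rewrite subrK => Dt.
  by rewrite (proj2 (max_domain_sub Ds)) subrK.
split.
- rewrite closure_id; apply/seteqP; split; first exact: subset_closure.
  move=> t It; have [s [[Ds sc]]] := It _ (nbhsx_ballx t d d0).
  rewrite /ball/= => ts.
  have dts : - d < t - s.
    by rewrite ltrNl opprB (le_lt_trans (ler_norm _))// distrC.
  have [+ _] := forward _ _ sc dts.
  rewrite max_domain_flow//= subrK => Dt; split=> //.
  rewrite leNgt; apply/negP => gtrho.
  have [_ _ _ _ Phid] := max_flow_solution x.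
  have /is_derive_continuous fc := Phid _ Dt.
  have : \forall z \near t, rho < `|max_flow x z - c|.
    have : `|max_flow x z - c| @[z --> t] --> `|max_flow x t - c|.
      by apply: cvg_norm; apply: cvgB; [exact: fc|exact: cvg_cst].
    by move=> /cvgr_gt; exact.
  by move=> /It[z [[_ zc]]] /=; rewrite ltNge zc.
- by move=> s t Is _ z /andP[sz _]; exact: up sz.
- move=> t; rewrite /= in_itv/= andbT => t0; apply: up t0.
  have [_ _ D0 Phi0 _] := max_flow_solution x.
  by split=> //; rewrite Phi0.
Qed.

End MaximalFlow.

(** * Completeness of the space of kernels *)

Lemma geometric_increments_dist {R : realType} {E : completeNormedModType R}
    (a : nat -> E) (C : R) (n : nat) :
  (forall n, `|a n.+1 - a n| <= C * mesh n) ->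
  `|lim (a m @[m --> \oo]) - a n| <= 2 * C * mesh n.
Proof.
move=> aC; have C0 : 0 <= C.
  by have := le_trans (normr_ge0 _) (aC 0%N); rewrite /mesh expr0 mulr1.
have adist m : `|a (m + n)%N - a n| <= 2 * C * (mesh n - mesh (m + n)).
  elim: m => [|m IHm]; first by rewrite !subrr normr0 mulr0.
  rewrite addSn -(subrKA (a (m + n)%N)).
  apply: le_trans (ler_normD _ _) _; apply: le_trans (lerD (aC _) IHm) _.
  by rewrite meshS; lra.
apply: (@ler_cvg_to _ (\oo) _ _ (fun m => `|a m - a n|) (cst (2 * C * mesh n))).
- by apply: cvg_norm; apply: cvgB; [exact: geometric_increments_cvg aC|exact: cvg_cst].
- exact: cvg_cst.
- near=> m; have nm : (n <= m)%N by near: m; exact: nbhs_infty_ge.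
  rewrite -(subnK nm) (le_trans (adist _))// ler_wpM2l ?mulr_ge0//.
  by rewrite gerBl ltW// mesh_gt0.
Unshelve. all: by end_near. Qed.

Section Clamp.
Context {R : realType}.
Implicit Types (c x : R).

(** Used to turn almost everywhere bounds on representatives into bounds at every point. *)
Definition clamp c x := Num.max (- c) (Num.min c x).

Lemma norm_clamp c x : 0 <= c -> `|clamp c x| <= c.
Proof.
move=> c0; rewrite /clamp ler_norml le_max lexx /= ge_max ge_min lexx andbT.
by rewrite (@le_trans _ _ 0)// oppr_le0.
Qed.

Lemma clamp_id c x : `|x| <= c -> clamp c x = x.
Proof. by rewrite ler_norml /clamp => /andP[cx xc]; rewrite min_r// max_r. Qed.

Lemma measurable_clamp d (T : measurableType d) c (f : T -> R) :
  measurable_fun setT f -> measurable_fun setT (clamp c \o f).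
Proof.
move=> mf; apply: measurable_maxr; first exact: measurable_cst.
by apply: measurable_minr => //; exact: measurable_cst.
Qed.

End Clamp.

(** * Null sets of the product measure *)

Section AlmostEverywhereProduct.
Context {d} {T : measurableType d} {R : realType} (P : probability T R).
Notation PP := (P \x P)%E.

(** The image of the product measure under the swap agrees with it on rectangles, hence on all
    measurable sets. *)
Lemma ae_swap (S : T * T -> Prop) :
  {ae PP, forall z, S z} -> {ae PP, forall z, S (z.2, z.1)}.
Proof.
pose sw (z : T * T) := (z.2, z.1).
have msw : measurable_fun setT sw.
  by apply: measurable_fun_pair; [exact: measurable_snd|exact: measurable_fst].
move=> [N [mN N0 SN]]; exists (sw @^-1` N); split.
- by rewrite -[X in measurable X]setTI; exact: msw.
- have := @product_measure_unique _ _ _ _ R P P (pushforward PP sw) _ N mN.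
  rewrite N0 => -> // A B mA mB.
  transitivity (PP (B `*` A)); last by rewrite product_measure1E// muleC.
  by congr (PP _); apply/seteqP; split=> -[x y] /= [].
- by move=> z /= Sz; exact: (SN (sw z)).
Qed.

Lemma ae_fst (A : T -> Prop) : {ae P, forall x, A x} -> {ae PP, forall z, A z.1}.
Proof.
move=> [N [mN N0 AN]]; exists (N `*` setT); split.
- exact: measurableX.
- transitivity (P N * P setT)%E; first by rewrite product_measure1E.
  by move: N0 => /= ->; rewrite mul0e.
- by move=> z /= Az; split => //; exact: AN.
Qed.

Lemma ae_snd (A : T -> Prop) : {ae P, forall x, A x} -> {ae PP, forall z, A z.2}.
Proof. by move=> /ae_fst/ae_swap. Qed.

(** The measure of a null set is the integral of the measures of its sections, so almost all of
    these vanish. *)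
Lemma ae_sections (S : T * T -> Prop) : {ae PP, forall z, S z} ->
  {ae P, forall x, {ae P, forall y, S (x, y)}}.
Proof.
move=> [N [mN N0 SN]].
have mxs : measurable_fun setT (P \o xsection N) by exact: measurable_fun_xsection.
have : ae_eq P setT (P \o xsection N) (cst 0%E).
  apply/ae_eq_integral_abs => //; rewrite -[RHS]N0.
  by apply: eq_integral => x _; rewrite gee0_abs.
apply: filterS => x /= /(_ I) Nx; exists (xsection N x); split => //.
  exact: measurable_xsection.
by move=> y /= Sxy; rewrite /xsection /= inE; exact: SN.
Qed.

End AlmostEverywhereProduct.

Section KernelComplete.
Context {d} {T : measurableType d} {R : realType} {P : probability T R}.
Notation PP := (P \x P)%E.
Implicit Types (V W : kernel_space P).

Lemma repr_kernelB V W : {ae PP, forall z, repr (V - W) z = repr V z - repr W z}.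
Proof.
have := repr_kernelD (V - W) W; rewrite subrK.
by apply: filterS => z ->; rewrite addrK.
Qed.

Lemma kernel_normB_le V W (M : R) :
  {ae PP, forall z, `|repr V z - repr W z| <= M} -> `|V - W| <= M.
Proof.
by move=> VW; apply/kernel_norm_leP; apply: filterS2 (repr_kernelB V W) VW => z ->.
Qed.

Lemma kernel_normB_ae V W : {ae PP, forall z, `|repr V z - repr W z| <= `|V - W|}.
Proof.
by apply: filterS2 (repr_kernelB V W) (kernel_normP (V - W)) => z ->.
Qed.

Lemma kernel_geometric_cvg (W : nat -> kernel_space P) (C : R) :
  (forall n, `|W n.+1 - W n| <= C * mesh n) ->
  exists V, forall n, `|V - W n| <= 2 * C * mesh n.
Proof.
move=> WC; have Cs0 n : 0 <= C * mesh n by exact: le_trans (WC n).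
have C0 : 0 <= C by have := Cs0 0%N; rewrite /mesh expr0 mulr1.
pose g n := clamp (C * mesh n) \o repr (W n.+1 - W n).
pose a n z := repr (W 0%N) z + \sum_(i < n) g i z.
have aE n z : a n.+1 z = a n z + g n z by rewrite /a big_ord_recr addrA.
have aS z n : `|a n.+1 z - a n z| <= C * mesh n.
  by rewrite aE addrAC subrr add0r norm_clamp.
pose f z := lim (a n z @[n --> \oo]).
have acvg z : a n z @[n --> \oo] --> f z.
  exact: (geometric_increments_cvg (aS z)).
have fa z n : `|f z - a n z| <= 2 * C * mesh n.
  exact: (geometric_increments_dist n (aS z)).
have [mW0 bW0 sW0] := kernel_funP (repr (W 0%N)).
have mg n : measurable_fun setT (g n).
  by have [mg _ _] := kernel_funP (repr (W n.+1 - W n)); exact: measurable_clamp.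
have ma n : measurable_fun setT (a n).
  elim: n => [|n IHn].
    rewrite (_ : a 0%N = repr (W 0%N))//.
    by apply/funext => z; rewrite /a big_ord0 addr0.
  rewrite (_ : a n.+1 = a n \+ g n); first exact: measurable_funD.
  by apply/funext => z; rewrite aE.
have aW : {ae PP, forall z, forall n, a n z = repr (W n) z}.
  apply: ae_foralln => n; elim: n => [|n IHn].
    by apply/nearW => z; rewrite /a big_ord0 addr0.
  have := repr_kernelB (W n.+1) (W n); have := kernel_normP (W n.+1 - W n).
  move: IHn; apply: filterS3 => z az Wz WBz.
  rewrite -[repr (W n.+1) z](subrK (repr (W n) z)) -WBz -az addrC.
  rewrite aE; congr (_ + _); rewrite /g /= clamp_id//.
  exact: le_trans (WC n).
have fK : is_kernel_fun P f.
  split.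
  - by apply: (measurable_fun_cvg ma) => z _; exact: acvg.
  - move/Defs.bounded_funP: bW0 => [M WM].
    apply/Defs.bounded_funP; exists (2 * C + M) => z.
    rewrite -(subrK (a 0%N z) (f z)) (le_trans (ler_normD _ _))// lerD//.
      by have := fa z 0%N; rewrite /mesh expr0 mulr1.
    by rewrite /a big_ord0 addr0.
  - have Wsym : {ae PP, forall z, forall n, repr (W n) z = repr (W n) (z.2, z.1)}.
      by apply: ae_foralln => n; have [] := kernel_funP (repr (W n)).
    apply: filterS3 Wsym aW (ae_swap aW) => z Wz az asz.
    rewrite /f (_ : a^~ z = a^~ (z.2, z.1))//.
    by apply/funext => n; rewrite az Wz asz.
pose V : kernel_space P := \pi_(kernel_space P)%qT (KernelFun (asboolT fK)).
exists V => n; apply: kernel_normB_le.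
have := repr_pi_kernel (P := P) (KernelFun (asboolT fK)); move: aW.
by apply: filterS2 => z <- ->; exact: fa.
Qed.

Lemma kernel_space_complete (F : set_system (kernel_space P)) :
  ProperFilter F -> cauchy F -> cvg F.
Proof.
move=> FF /cauchyP Fc.
have [W WF] : exists W : nat -> kernel_space P, forall n, F (ball (W n) (mesh n)).
  have /choice[W WF] : forall n, exists W, F (ball W (mesh n)).
    by move=> n; have [W] := Fc _ (mesh_gt0 n); exists W.
  by exists W.
(* Two members of the filter meet, so the balls of radii [mesh n] and [mesh n / 2] share a point and
   their centres are less than [2 * mesh n] apart. *)
have [|V VW] := @kernel_geometric_cvg W 2.
  move=> n; have [U []] := filter_ex (filterI (WF n) (WF n.+1)).
  rewrite -!ball_normE /= => Un UnS; rewrite -(subrKA U).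
  have sn := mesh_gt0 (R := R) n; move: UnS; rewrite meshS => UnS.
  by apply: le_trans (ler_normD _ _) _; rewrite [`|U - _|]distrC; lra.
apply/cvg_ex; exists V; apply/cvgrPdist_le => e e0.
(* The limit is within [4 * mesh n] of the centre [W n], and the ball adds one more [mesh n]. *)
have [n sn] : exists n, 5 * mesh n <= e.
  have : \forall n \near \oo, mesh n <= e / 5.
    by apply: (cvgr_le 0 mesh_cvg0); rewrite divr_gt0.
  by move=> /filter_ex[n sn]; exists n; move: sn; lra.
apply: filterS (WF n) => U; rewrite -ball_normE /= => WU.
rewrite -(subrKA (W n)) (le_trans (ler_normD _ _))//.
by have := VW n; lra.
Qed.

HB.instance Definition _ :=
  Uniform_isComplete.Build (kernel_space P) kernel_space_complete.

End KernelComplete.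

(** * The velocity is locally Lipschitz *)

Section IteratedIntegralTheory.
Context {d} {T : measurableType d} {R : realType} (P : probability T R).
Context {I : eqType}.
Notation PP := (P \x P)%E.
Implicit Types (s : seq I) (f g : (I -> T) -> R) (x y : I -> T).

Lemma bounded_integrable (f : T -> R) (M : R) : measurable_fun setT f ->
  (forall t, `|f t| <= M) -> P.-integrable setT (EFin \o f).
Proof.
move=> mf fM.
have icst : P.-integrable setT (EFin \o cst M).
  exact: finite_measure_integrable_cst.
apply: le_integrable icst => //; first exact/measurable_EFinP.
by move=> t _ /=; rewrite lee_fin (le_trans (fM t))// ler_norm.
Qed.

Lemma measurable_iterated_integral_update s f i x :
  coordinatewise_measurable f ->
  measurable_fun setT
    (fun t => iterated_integral P s f [eta x with i |-> t]).
Proof.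
move=> mf; apply: (@iterated_integral_measurable _ _ _ P I s f mf _ T
  (fun t => [eta x with i |-> t])) => j /=.
by case: (j == i); [exact: measurable_id|exact: measurable_cst].
Qed.

Lemma iterated_integralB s f g (M N : R) x :
  coordinatewise_measurable f -> coordinatewise_measurable g ->
  (forall y, `|f y| <= M) -> (forall y, `|g y| <= N) ->
  iterated_integral P s f x - iterated_integral P s g x =
  iterated_integral P s (fun y => f y - g y) x.
Proof.
move=> mf mg fM gN; elim: s x => [|i s IHs] x //=.
rewrite -RintegralB//.
- by apply: eq_Rintegral => t _; exact: IHs.
- apply: (bounded_integrable (M := M)).
    exact: measurable_iterated_integral_update.
  by move=> t; exact: iterated_integral_bounded.
- apply: (bounded_integrable (M := N)).
    exact: measurable_iterated_integral_update.
  by move=> t; exact: iterated_integral_bounded.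
Qed.

(** Only points agreeing with [x] off [s] are visited by the integral, so [l] and [u] may depend on
    the coordinates that stay fixed, such as the two roots. *)
Lemma iterated_integral_itv s f (M l u : R) x :
  coordinatewise_measurable f -> (forall y, `|f y| <= M) ->
  (forall y, {in [predC s], x =1 y} -> l <= f y <= u) ->
  l <= iterated_integral P s f x <= u.
Proof.
move=> mf fM; elim: s x => [|i s IHs] x flu /=; first exact: flu.
have {}IHs t : l <= iterated_integral P s f [eta x with i |-> t] <= u.
  apply: IHs => y xy; apply: flu => j; rewrite !inE negb_or => /andP[ji js].
  by rewrite -xy ?inE//= (negbTE ji).
have cstE c : \int[P]_t (cst c t) = c.
  rewrite Rintegral_cst// [X in _ * X](_ : _ = 1) ?mulr1//.
  exact: (congr1 fine (probability_setT P)).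
have icst c : P.-integrable setT (EFin \o cst c).
  exact: finite_measure_integrable_cst.
have iF : P.-integrable setT
    (EFin \o (fun t => iterated_integral P s f [eta x with i |-> t])).
  apply: (bounded_integrable (M := M)).
    exact: measurable_iterated_integral_update.
  by move=> t; exact: iterated_integral_bounded.
apply/andP; split.
  rewrite -[leLHS]cstE; apply: le_Rintegral => // t _.
  by have /andP[] := IHs t.
rewrite -[leRHS]cstE; apply: le_Rintegral => // t _.
by have /andP[] := IHs t.
Qed.

(** Almost every point, read one coordinate at a time in the order of integration, so that no
    measure on [I -> T] has to be built. *)
Fixpoint iterated_ae s (Q : (I -> T) -> Prop) x : Prop :=
  if s is i :: s' then {ae P, forall t, iterated_ae s' Q [eta x with i |-> t]}
  else Q x.

Lemma iterated_ae_forall (J : finType) s (Q : J -> (I -> T) -> Prop) x :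
  (forall j, iterated_ae s (Q j) x) ->
  iterated_ae s (fun y => forall j, Q j y) x.
Proof.
elim: s x => [|i s IHs] x //= Qx.
have /filter_forall := Qx.
by apply: filterS => t Qt; exact: IHs.
Qed.

Lemma iterated_ae_sub s (Q Q' : (I -> T) -> Prop) x :
  (forall y, Q y -> Q' y) -> iterated_ae s Q x -> iterated_ae s Q' x.
Proof.
move=> QQ'; elim: s x => [|i s IHs] x /=; first exact: QQ'.
by apply: filterS => t; exact: IHs.
Qed.

Lemma iterated_aeT s (Q : (I -> T) -> Prop) x :
  (forall y, Q y) -> iterated_ae s Q x.
Proof.
by move=> QT; elim: s x => [|i s IHs] x //=; exact/nearW.
Qed.

Lemma iterated_integral_ae s f g x :
  coordinatewise_measurable f -> coordinatewise_measurable g ->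
  iterated_ae s (fun y => f y = g y) x ->
  iterated_integral P s f x = iterated_integral P s g x.
Proof.
move=> mf mg; elim: s x => [|i s IHs] x //= fg.
rewrite /Rintegral; congr fine; apply: ae_eq_integral => //.
- by apply/measurable_EFinP; exact: measurable_iterated_integral_update.
- by apply/measurable_EFinP; exact: measurable_iterated_integral_update.
- by apply: filterS fg => t fg _; rewrite (IHs _ fg).
Qed.

(** The last three hypotheses say what must hold at coordinates that are already fixed: both, [i]
    alone, or [j] alone. Fixing a further coordinate preserves them for almost every value, by
    passing to sections. *)
Lemma iterated_ae_pair (S : T * T -> Prop) (i j : I) s x : i != j ->
  {ae PP, forall z, S z} ->
  (i \notin s -> j \notin s -> S (x i, x j)) ->
  (i \notin s -> {ae P, forall t, S (x i, t)}) ->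
  (j \notin s -> {ae P, forall t, S (t, x j)}) ->
  iterated_ae s (fun y => S (y i, y j)) x.
Proof.
move=> ij aeS; have ji : j != i by rewrite eq_sym.
have aeS1 := ae_sections aeS; have aeS2 := ae_sections (ae_swap aeS).
elim: s x => [|l s IHs] x S0 S1 S2 /=; first exact: S0.
have S0' : {ae P, forall t, i \notin s -> j \notin s ->
    S ([eta x with l |-> t] i, [eta x with l |-> t] j)}.
  have [il|il] := eqVneq i l.
    have [js|js] := boolP (j \in s); first exact/nearW.
    have jls : j \notin l :: s by rewrite inE -il negb_or ji.
    by apply: filterS (S2 jls) => t St _ _; rewrite /= -il eqxx (negbTE ji).
  have [jl|jl] := eqVneq j l.
    have [js|js] := boolP (i \in s); first exact/nearW.
    have ils : i \notin l :: s by rewrite inE negb_or il.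
    by apply: filterS (S1 ils) => t St _ _; rewrite /= -jl eqxx (negbTE ij).
  apply/nearW => t si sj; rewrite /= (negbTE il) (negbTE jl).
  by apply: S0; rewrite inE negb_or ?il ?jl.
have S1' : {ae P, forall t, i \notin s ->
    {ae P, forall t', S ([eta x with l |-> t] i, t')}}.
  have [il|il] := eqVneq i l.
    by apply: filterS aeS1 => t St _; rewrite /= il eqxx.
  apply/nearW => t si; rewrite /= (negbTE il).
  by apply: S1; rewrite inE negb_or il.
have S2' : {ae P, forall t, j \notin s ->
    {ae P, forall t', S (t', [eta x with l |-> t] j)}}.
  have [jl|jl] := eqVneq j l.
    by apply: filterS aeS2 => t St _; rewrite /= jl eqxx.
  apply/nearW => t sj; rewrite /= (negbTE jl).
  by apply: S2; rewrite inE negb_or jl.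
by apply: filterS3 S0' S1' S2' => t *; exact: IHs.
Qed.

End IteratedIntegralTheory.

(** * The velocity depends only on the class of the kernel *)

Section VelocityAlmostEverywhere.
Context {d} {T : measurableType d} {R : realType} (P : probability T R).
Notation PP := (P \x P)%E.
Implicit Types (V W : T * T -> R).

Lemma eq_graph_density k (F : graph k) V W (x : 'I_k -> T) :
  (forall i j : 'I_k, (i < j)%N -> V (x i, x j) = W (x i, x j)) ->
  graph_density F V x = graph_density F W x.
Proof.
move=> VW; rewrite /graph_density; congr (_ * _);
  apply: eq_bigr => i _; apply: eq_bigr => j /andP[ij _]; by rewrite VW.
Qed.

(** The density reads the kernel at finitely many pairs of distinct vertices. For almost every
    position of the roots, [iterated_ae_pair] makes [V] and [W] agree at each of them. *)
Lemma rooted_density_ae k (F : graph k) (a b : 'I_k) V W : a != b ->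
  measurable_fun setT V -> measurable_fun setT W ->
  {ae PP, forall z, V z = W z} ->
  {ae PP, forall z, rooted_density P F a b V z = rooted_density P F a b W z}.
Proof.
move=> ab mV mW VW.
have VWsec := ae_sections VW; have VWsec' := ae_sections (ae_swap VW).
near=> z; apply: iterated_integral_ae; try exact: graph_density_measurable.
set s := [seq i <- _ | _].
pose x (i : 'I_k) := if i == a then z.1 else z.2; rewrite -/x.
have sP i : i \notin s -> i = a \/ i = b.
  rewrite mem_filter mem_enum andbT negb_and !negbK.
  by move=> /orP[] /eqP; [left|right].
have xa : x a = z.1 by rewrite /x eqxx.
have xb : x b = z.2 by rewrite /x eq_sym (negbTE ab).
apply: (@iterated_ae_sub _ _ _ _ _ _
    (fun y => forall i j, i != j -> V (y i, y j) = W (y i, y j))).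
  by move=> y VWy; apply: eq_graph_density => i j ij; apply: VWy; rewrite neq_ltn ij.
apply: iterated_ae_forall => i; apply: iterated_ae_forall => j.
have [->|ij] := eqVneq i j.
  by apply: iterated_aeT => y.
apply: (@iterated_ae_sub _ _ _ _ _ _ (fun y => V (y i, y j) = W (y i, y j))) => //.
apply: (iterated_ae_pair (S := fun p => V p = W p)) => //.
- move=> /sP ia /sP jb; move: ij; case: ia => ->; case: jb => ->;
    rewrite ?eqxx// ?xa ?xb => _.
  + near: z; by apply: filterS VW => -[].
  + near: z; exact: (ae_swap VW).
- move=> /sP[] ->; rewrite ?xa ?xb.
  + by near: z; exact: (ae_fst VWsec).
  + by near: z; exact: (ae_snd VWsec).
- move=> /sP[] ->; rewrite ?xa ?xb.
  + by near: z; exact: (ae_fst VWsec').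
  + by near: z; exact: (ae_snd VWsec').
Unshelve. all: by end_near. Qed.

Lemma velocity_fun_ae k (r : graph k -> graph k -> R) V W :
  measurable_fun setT V -> measurable_fun setT W ->
  {ae PP, forall z, V z = W z} ->
  {ae PP, forall z, velocity_fun P r V z = velocity_fun P r W z}.
Proof.
move=> mV mW VW.
have VWFab (F : graph k) a b : {ae PP, forall z, a != b ->
    rooted_density P F a b V z = rooted_density P F a b W z}.
  have [->|ab] := eqVneq a b; first exact/nearW.
  by apply: filterS (rooted_density_ae F ab mV mW VW) => z.
have VWFa (F : graph k) (a : 'I_k) : {ae PP, forall z, forall b : 'I_k, a != b ->
    rooted_density P F a b V z = rooted_density P F a b W z}.
  exact: (filter_forall _ (VWFab F a)).
have VWF (F : graph k) : {ae PP, forall z, forall a b : 'I_k, a != b ->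
    rooted_density P F a b V z = rooted_density P F a b W z}.
  exact: (filter_forall _ (VWFa F)).
have : {ae PP, forall z, forall (F : graph k) (a b : 'I_k), a != b ->
    rooted_density P F a b V z = rooted_density P F a b W z}.
  exact: (filter_forall _ VWF).
apply: filterS => z VWz; apply: eq_bigr => F _; apply: eq_bigr => H _.
by congr (_ * _); apply: eq_bigr => a _; apply: eq_bigr => b ab; rewrite VWz.
Qed.

End VelocityAlmostEverywhere.

(** * Lipschitz bounds for the velocity *)

Section VelocityLipschitz.
Context {d} {T : measurableType d} {R : realType} (P : probability T R).
Notation PP := (P \x P)%E.

(* Boundedness and Lipschitz dependence on the kernel of a functional [h],
   uniformly in the points [y] at which the kernel is evaluated; the uncurried
   form makes [big_closed] applicable. *)
Definition kernel_lipschitz (M : R) (Y : Type) (h : (T * T -> R) * Y -> R) :=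
  exists B C : R, forall (V W : T * T -> R) (delta : R) (y : Y),
    measurable_fun setT V -> measurable_fun setT W ->
    (forall z, `|V z| <= M) -> (forall z, `|W z| <= M) ->
    (forall z, `|V z - W z| <= delta) ->
    `|h (V, y)| <= B /\ `|h (V, y) - h (W, y)| <= C * delta.

Section Closure.
Context (M : R) (Y : Type).
Implicit Types (f g : (T * T -> R) * Y -> R).
Local Notation Q := (@kernel_lipschitz M Y).

Lemma kernel_lipschitz_cst (c : R) : Q (fun=> c).
Proof.
exists `|c|, 0 => V W delta y _ _ _ _ _.
by rewrite subrr normr0 mul0r lexx.
Qed.

Lemma kernel_lipschitz_eval (p : Y -> T * T) : Q (fun v => v.1 (p v.2)).
Proof.
by exists M, 1 => V W delta y _ _ VM _ VW; rewrite mul1r; split; [exact: VM|exact: VW].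
Qed.

Lemma kernel_lipschitzD f g : Q f -> Q g -> Q (fun v => f v + g v).
Proof.
move=> [B [C fBC]] [B' [C' gBC]]; exists (B + B'), (C + C').
move=> V W delta y mV mW VM WM VW.
have [fB fC] := fBC V W delta y mV mW VM WM VW.
have [gB gC] := gBC V W delta y mV mW VM WM VW.
rewrite opprD addrACA mulrDl; split;
  by rewrite (le_trans (ler_normD _ _))// lerD.
Qed.

Lemma kernel_lipschitzM f g : Q f -> Q g -> Q (fun v => f v * g v).
Proof.
move=> [B [C fBC]] [B' [C' gBC]]; exists (B * B'), (B * C' + B' * C).
move=> V W delta y mV mW VM WM VW.
have [fB fC] := fBC V W delta y mV mW VM WM VW.
have [gB gC] := gBC V W delta y mV mW VM WM VW.
(* The bound on [g] at [W] comes from comparing [W] with itself, with [delta = 0]. *)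
have [|gB' _] := gBC W W 0 y mW mW WM WM; first by move=> z; rewrite subrr normr0.
split; first by rewrite normrM ler_pM.
have -> : f (V, y) * g (V, y) - f (W, y) * g (W, y) =
  f (V, y) * (g (V, y) - g (W, y)) + g (W, y) * (f (V, y) - f (W, y)) by ring.
rewrite (le_trans (ler_normD _ _))// mulrDl -!mulrA lerD// normrM ler_pM//.
Qed.

Lemma kernel_lipschitz_sum I (s : seq I) (A : pred I) (h : I -> _ -> R) :
  (forall i, A i -> Q (h i)) -> Q (fun v => \sum_(i <- s | A i) h i v).
Proof.
by move=> Qh; apply: (big_closed (Q := Q)) => //;
  [exact: kernel_lipschitz_cst|exact: kernel_lipschitzD].
Qed.

Lemma kernel_lipschitz_prod I (s : seq I) (A : pred I) (h : I -> _ -> R) :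
  (forall i, A i -> Q (h i)) -> Q (fun v => \prod_(i <- s | A i) h i v).
Proof.
by move=> Qh; apply: (big_closed (Q := Q)) => //;
  [exact: kernel_lipschitz_cst|exact: kernel_lipschitzM].
Qed.

End Closure.

Lemma graph_density_kernel_lipschitz M k (F : graph k) :
  @kernel_lipschitz M ('I_k -> T) (fun v => graph_density F v.1 v.2).
Proof.
have Qev i j : @kernel_lipschitz M ('I_k -> T) (fun v => v.1 (v.2 i, v.2 j)).
  exact: (@kernel_lipschitz_eval M _ (fun x => (x i, x j))).
apply: kernel_lipschitzM; apply: kernel_lipschitz_prod => i _;
  apply: kernel_lipschitz_prod => j _ //.
apply: kernel_lipschitzD; first exact: kernel_lipschitz_cst.
have [B [C BC]] := Qev i j; exists B, C => V W delta y mV mW VM WM VW.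
by rewrite normrN -opprD normrN; exact: BC.
Qed.

Lemma rooted_density_kernel_lipschitz M k (F : graph k) a b :
  @kernel_lipschitz M (T * T) (fun v => rooted_density P F a b v.1 v.2).
Proof.
have [B [C BC]] := graph_density_kernel_lipschitz M F.
exists B, C => V W delta z mV mW VM WM VW /=.
have mgV := graph_density_measurable F mV; have mgW := graph_density_measurable F mW.
have VB y : `|graph_density F V y| <= B := (BC V W delta y mV mW VM WM VW).1.
have WB y : `|graph_density F W y| <= B.
  by apply: (BC W W 0 y mW mW WM WM _).1 => t; rewrite subrr normr0.
split; first exact: iterated_integral_bounded.
rewrite /rooted_density (iterated_integralB P _ _ mgV mgW VB WB).
apply: iterated_integral_bounded.
  by move=> d' Z phi mphi; apply: measurable_funB; [exact: mgV|exact: mgW].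
by move=> y; exact: (BC V W delta y mV mW VM WM VW).2.
Qed.

Lemma velocity_fun_kernel_lipschitz M k (r : graph k -> graph k -> R) :
  @kernel_lipschitz M (T * T) (fun v => velocity_fun P r v.1 v.2).
Proof.
apply: kernel_lipschitz_sum => F _; apply: kernel_lipschitz_sum => H _.
apply: kernel_lipschitzM; first exact: kernel_lipschitz_cst.
apply: kernel_lipschitz_sum => a _; apply: kernel_lipschitz_sum => b _.
apply: kernel_lipschitzM; first exact: rooted_density_kernel_lipschitz.
exact: kernel_lipschitz_cst.
Qed.

Lemma repr_velocity_ae k (r : graph k -> graph k -> R) (W : kernel_space P)
    (w : T * T -> R) :
  measurable_fun setT w -> {ae PP, forall z, repr W z = w z} ->
  {ae PP, forall z, repr (velocity r W) z = velocity_fun P r w z}.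
Proof.
move=> mw Ww; have [mW _ _] := kernel_funP (repr W).
have := velocity_fun_ae r mW mw Ww.
apply: filterS2 (repr_pi_kernel (P := P) (KernelFun (asboolT
  (velocity_is_kernel_fun r (kernel_funP (repr W)))))) => z.
by rewrite /velocity => -> /= ->.
Qed.

Lemma velocity_bounded_lipschitz k (r : graph k -> graph k -> R) :
  bounded_lipschitz (velocity r : kernel_space P -> kernel_space P).
Proof.
(* The radius is [3 * M] because the second representative below is a function bounded by [M] minus
   one bounded by [delta], itself at most [2 * M]. *)
move=> M; have [B [C BC]] := velocity_fun_kernel_lipschitz (3 * M) r.
exists `|C| => // V W VM WM.
have M0 : 0 <= M by exact: le_trans VM.
set delta := `|V - W|.
have dM : delta <= 2 * M.
  by apply: le_trans (ler_normB _ _) _; move: VM WM; lra.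
have [mV _ _] := kernel_funP (repr V); have [mW _ _] := kernel_funP (repr W).
pose v := clamp M \o repr V.
pose dvw := clamp delta \o (repr V \- repr W).
(* Clamping the difference, not [W] itself, keeps [v] and [w] within [delta] of each other at every
   point. *)
pose w := v \- dvw.
have mv : measurable_fun setT v by exact: measurable_clamp.
have md : measurable_fun setT dvw.
  by apply: measurable_clamp; exact: measurable_funB.
have mw : measurable_fun setT w by exact: measurable_funB.
have vM z : `|v z| <= M by exact: norm_clamp.
have dd z : `|dvw z| <= delta by apply: norm_clamp; exact: normr_ge0.
have vw z : `|v z - w z| <= delta by rewrite /w /= opprB addrC subrK.
have Vv : {ae PP, forall z, repr V z = v z}.
  apply: filterS (kernel_normP V) => z Vz; rewrite /v /= clamp_id//.
  exact: le_trans Vz VM.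
have Ww : {ae PP, forall z, repr W z = w z}.
  apply: filterS2 Vv (kernel_normB_ae V W) => z Vz VWz.
  by rewrite /w /dvw /= -Vz clamp_id// opprB addrC subrK.
have := repr_velocity_ae r mw Ww; have := repr_velocity_ae r mv Vv.
move=> vV vW; apply: kernel_normB_le; apply: filterS2 vV vW => z -> ->.
have [| |_] := BC v w delta z mv mw _ _ vw.
- by move=> y; rewrite (le_trans (vM y))//; lra.
- move=> y; rewrite (le_trans (ler_normB _ _))//.
  by have := vM y; have := dd y; move: dM; rewrite /=; lra.
by move=> /le_trans; apply; rewrite ler_wpM2r ?normr_ge0// ler_norm.
Qed.

End VelocityLipschitz.

(** * Graphons *)

Section BoundedBigops.
Context {R : realType} {I : finType}.
Implicit Types (A : pred I) (f : I -> R).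

Lemma prodr_itv01 A f : (forall i, A i -> 0 <= f i <= 1) ->
  0 <= \prod_(i | A i) f i <= 1.
Proof.
move=> f01; rewrite prodr_ile1 ?andbT//.
by apply: prodr_ge0 => i /f01/andP[].
Qed.

Lemma prodr_le_factor A f i : (forall j, A j -> 0 <= f j <= 1) -> A i ->
  \prod_(j | A j) f j <= f i.
Proof.
move=> f01 Ai; rewrite (bigD1 i)//=; have /andP[fi0 _] := f01 i Ai.
rewrite ler_piMr//; apply: (andP (prodr_itv01 _)).2 => j /andP[Aj _].
exact: f01.
Qed.

Lemma sumr_itv A f (l u : R) : 0 <= l -> 0 <= u ->
  (forall i, A i -> - l <= f i <= u) ->
  - (#|I|%:R * l) <= \sum_(i | A i) f i <= #|I|%:R * u.
Proof.
move=> l0 u0 flu; have sumE c : #|I|%:R * c = \sum_(i : I) c.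
  by rewrite sumr_const mulr_natl.
rewrite 2!sumE -sumrN [\sum_(i | A i) f i]big_mkcond; apply/andP.
by split; apply: ler_sum => i _; case: ifPn => [/flu/andP[]//|_]; rewrite ?oppr_le0.
Qed.

End BoundedBigops.

(** * The velocity on graphons *)

Section Graphons.
Context {d} {T : measurableType d} {R : realType} (P : probability T R).
Notation PP := (P \x P)%E.

(** Bounds the number of summands indexed by [F], [H], [a], [b], each weighted by at most 1; this is
    the constant [N] of the one-sided bounds. *)
Definition velocity_terms k : R :=
  #|{: graph k}|%:R * (#|{: graph k}|%:R * (k%:R * k%:R)).

Section PointwiseBounds.
Context (W : T * T -> R) (mW : measurable_fun setT W)
  (W01 : forall z, 0 <= W z <= 1).

Let W01C z : 0 <= 1 - W z <= 1.
Proof. by have /andP[W0 W1] := W01 z; rewrite subr_ge0 W1 gerBl. Qed.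

Lemma graph_density_itv01 k (F : graph k) x : 0 <= graph_density F W x <= 1.
Proof.
have [] : 0 <= \prod_(i < k) \prod_(j < k | (i < j)%N && edge F i j)
      W (x i, x j) <= 1 /\
    0 <= \prod_(i < k) \prod_(j < k | (i < j)%N && ~~ edge F i j)
      (1 - W (x i, x j)) <= 1.
  by split; apply: prodr_itv01 => i _; exact: prodr_itv01.
move=> /andP[p0 p1] /andP[q0 q1]; rewrite /graph_density mulr_ge0//=.
by rewrite -[leRHS]mul1r ler_pM.
Qed.

(** All factors lie between 0 and 1, so the product is at most any one of them. *)
Lemma graph_density_le_edge k (F : graph k) x (i j : 'I_k) : (i < j)%N ->
  graph_density F W x <= if edge F i j then W (x i, x j) else 1 - W (x i, x j).
Proof.
move=> ij; rewrite /graph_density.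
set p := \prod_(i < k) _; set q := \prod_(i < k) _.
have /andP[p0 p1] : 0 <= p <= 1.
  by apply: prodr_itv01 => i' _; exact: prodr_itv01.
have /andP[q0 q1] : 0 <= q <= 1.
  by apply: prodr_itv01 => i' _; exact: prodr_itv01.
case: ifPn => Fij.
  rewrite (le_trans (ler_piMr p0 q1))//.
  apply: le_trans (prodr_le_factor (i := i) _ _) _ => //.
    by move=> i' _; exact: prodr_itv01.
  by apply: (prodr_le_factor (i := j)) => //; rewrite ij.
rewrite (le_trans (ler_piMl q0 p1))//.
apply: le_trans (prodr_le_factor (i := i) _ _) _ => //.
  by move=> i' _; exact: prodr_itv01.
by apply: (prodr_le_factor (i := j)) => //; rewrite ij.
Qed.

(** The density reads each pair with the smaller vertex first; symmetry of [W] at [z] covers the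
    case where [b] precedes [a]. *)
Lemma rooted_density_itv k (F : graph k) (a b : 'I_k) z : a != b ->
  W (z.2, z.1) = W z ->
  0 <= rooted_density P F a b W z <= if edge F a b then W z else 1 - W z.
Proof.
move=> ab Wz; apply: (@iterated_integral_itv _ _ _ P _ _ _ 1).
- exact: graph_density_measurable.
- by move=> y; have /andP[g0 g1] := graph_density_itv01 F y; rewrite ger0_norm.
move=> y zy; have /andP[-> _] /= := graph_density_itv01 F y.
have ya : y a = z.1 by rewrite -zy ?eqxx// !inE mem_filter eqxx.
have yb : y b = z.2.
  by rewrite -zy; rewrite ?inE ?mem_filter ?eqxx ?andbF// eq_sym (negbTE ab).
have [ltab|ltba|/ord_inj eab] := ltngtP a b.
- by have := graph_density_le_edge F y ltab; rewrite ya yb -surjective_pairing.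
- have := graph_density_le_edge F y ltba.
  by rewrite ya yb Wz edgeC.
- by rewrite eab eqxx in ab.
Qed.

Lemma velocity_fun_itv k (r : graph k -> graph k -> R) z : is_rule r ->
  W (z.2, z.1) = W z ->
  - (velocity_terms k * W z) <= velocity_fun P r W z
    <= velocity_terms k * (1 - W z).
Proof.
move=> [r01 _] Wz; have /andP[w0 w1] := W01 z; have /andP[v0 v1] := W01C z.
rewrite /velocity_terms -!mulrA.
have := sumr_itv (I := graph k) (A := predT).
apply=> [| |F _]; rewrite ?mulr_ge0//.
have := sumr_itv (I := graph k) (A := predT).
apply=> [| |H _]; rewrite ?mulr_ge0//.
set S := \sum_(a < k) _.
have /andP[S0 S1] : - (k%:R * (k%:R * W z)) <= S <= k%:R * (k%:R * (1 - W z)).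
  have := sumr_itv (I := 'I_k) (A := predT); rewrite card_ord.
  apply=> [| |a _]; rewrite ?mulr_ge0//.
  have := sumr_itv (I := 'I_k); rewrite card_ord; apply=> // b ab.
  have := rooted_density_itv F ab Wz.
  (* A positive sign needs [ab] absent from [F], where the density is at most [1 - W z]; a negative
     one needs it present, where the density is at most [W z]. *)
  case: (edge F a b); case: (edge H a b) => /= /andP[rho0 rho1];
    rewrite ?subrr ?subr0 ?sub0r ?mulr0 ?mulr1 ?mulrN1; lra.
have /andP[r0 r1] := r01 F H.
have kW : 0 <= k%:R * (k%:R * W z) by rewrite !mulr_ge0.
have kV : 0 <= k%:R * (k%:R * (1 - W z)) by rewrite !mulr_ge0.
apply/andP; split.
  rewrite (@le_trans _ _ (r F H * - (k%:R * (k%:R * W z))))//.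
    by rewrite mulrN lerN2 ler_piMl.
  by rewrite ler_wpM2l.
by rewrite (le_trans (ler_wpM2l r0 S1))// ler_piMl.
Qed.

End PointwiseBounds.

Lemma cst_is_kernel_fun (c : R) : is_kernel_fun P (cst c).
Proof.
split; first exact: measurable_cst.
  by apply/Defs.bounded_funP; exists `|c|.
exact/nearW.
Qed.

Definition half_kernel : kernel_space P :=
  \pi_(kernel_space P)%qT (KernelFun (asboolT (cst_is_kernel_fun 2^-1))).

Lemma repr_half_kernel : {ae PP, forall z, repr half_kernel z = 2^-1}.
Proof. exact: (repr_pi_kernel (P := P)). Qed.

Lemma graphonP (W : kernel_space P) : graphon W <-> `|W - half_kernel| <= 2^-1.
Proof.
have WhE := repr_kernelB W half_kernel; split.
  move=> Wg; apply/kernel_norm_leP.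
  apply: filterS3 Wg WhE repr_half_kernel => z Wz -> ->.
  by rewrite ler_norml; lra.
move=> /kernel_norm_leP Wh.
apply: filterS3 Wh WhE repr_half_kernel => z zh WE hE.
by move: zh; rewrite WE hE ler_norml; lra.
Qed.

(** The pointwise bounds need a representative with values between 0 and 1 everywhere; truncating
    around 1/2 provides it. *)
Lemma graphon_clampP (W : kernel_space P) : graphon W ->
  exists w : T * T -> R, [/\ measurable_fun setT w, forall z, 0 <= w z <= 1,
    {ae PP, forall z, repr W z = w z} &
    {ae PP, forall z, w (z.2, z.1) = w z}].
Proof.
move=> Wg; have [mW _ sW] := kernel_funP (repr W).
pose w z := 2^-1 + clamp (2^-1) (repr W z - 2^-1).
have Ww : {ae PP, forall z, repr W z = w z}.
  apply: filterS Wg => z Wz; rewrite /w clamp_id ?[_ + (_ - _)]addrC ?subrK//.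
  by rewrite ler_norml; lra.
exists w; split=> //.
- apply: measurable_funD; first exact: measurable_cst.
  by apply: measurable_clamp; apply: measurable_funB => //; exact: measurable_cst.
- move=> z; have : `|clamp 2^-1 (repr W z - 2^-1)| <= 2^-1.
    by apply: norm_clamp; rewrite invr_ge0.
  by rewrite /w ler_norml; lra.
- by apply: filterS sW => z Wz; rewrite /w Wz.
Qed.

(* On a graphon the velocity is at least [- N * W] and at most [N * (1 - W)],
   because removing (adding) the edge [ab] requires [ab] to be present
   (absent). *)
Lemma graphon_euler_step k (r : graph k -> graph k -> R) : is_rule r ->
  exists2 h0 : R, 0 < h0 & forall h (W : kernel_space P), 0 <= h <= h0 ->
    `|W - half_kernel| <= 2^-1 ->
    `|W + h *: velocity r W - half_kernel| <= 2^-1.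
Proof.
move=> rr.
pose N := velocity_terms k.
have N0 : 0 <= N by rewrite !mulr_ge0.
have N1 : 0 < N + 1 by rewrite ltr_wpDl.
(* Ensures [h * N <= 1], also when [N = 0]; then [w - h * N * w] is nonnegative and
   [w + h * N * (1 - w)] is at most 1. *)
exists (N + 1)^-1; first by rewrite invr_gt0.
move=> h W /andP[h0 hN] /graphonP Wg; apply/graphonP.
have hN1 : h * N <= 1.
  rewrite (@le_trans _ _ ((N + 1)^-1 * (N + 1)))//.
    by apply: ler_pM => //; rewrite lerDl.
  by rewrite mulVf// gt_eqF.
have [w [mw w01 Ww ws]] := graphon_clampP Wg.
have vel := repr_velocity_ae r mw Ww.
have hvel := repr_kernelZ h (velocity r W).
have WhE := repr_kernelD W (h *: velocity r W).
near=> z.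
have -> : repr (W + h *: velocity r W) z = w z + h * velocity_fun P r w z.
  have -> : repr (W + h *: velocity r W) z = repr W z + repr (h *: velocity r W) z.
    by near: z.
  have -> : repr (h *: velocity r W) z = h * repr (velocity r W) z by near: z.
  have -> : repr W z = w z by near: z.
  have -> // : repr (velocity r W) z = velocity_fun P r w z by near: z.
have wz : w (z.2, z.1) = w z by near: z.
have /andP[w0 w1] := w01 z.
have /andP[v0 v1] := velocity_fun_itv mw w01 rr wz.
rewrite -/N in v0 v1.
have a1 := ler_wpM2l h0 v0; have a2 := ler_wpM2l h0 v1.
have wC : 0 <= 1 - w z by rewrite subr_ge0.
have b1 := ler_wpM2r w0 hN1; have b2 := ler_wpM2r wC hN1.
apply/andP; split.
  by move: a1 b1; rewrite mulrN mulrA mul1r; lra.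
by move: a2 b2; rewrite mulrA mul1r; lra.
Unshelve. all: by end_near. Qed.

End Graphons.

Theorem theorem4p5 (d : measure_display) (T : measurableType d) (R : realType)
    (P : probability T R) (atomlessP : atomless P) (separableP : separable P)
    (k : nat) (r : graph k -> graph k -> R) (rule_r : is_rule r) :
  exists (D : kernel_space P -> set R)
    (Phi : kernel_space P -> R -> kernel_space P),
  [/\ forall W : kernel_space P,
        trajectory r W (D W) (Phi W) /\
        (forall (I : set R) (Psi : R -> kernel_space P), trajectory r W I Psi ->
          I `<=` D W /\ forall t, I t -> Psi t = Phi W t),
      forall (W : kernel_space P) (u : R), D W u ->
        D (Phi W u) = [set t | D W (t + u)] /\
        (forall t, D (Phi W u) t -> Phi (Phi W u) t = Phi W (t + u))
    & forall W : kernel_space P, graphon W ->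
        let I_W := [set t | D W t /\ graphon (Phi W t)] in
        [/\ closed I_W, is_interval I_W & `[0, +oo[ `<=` I_W]].
Proof.
have V_lip := velocity_bounded_lipschitz P r.
have [h0 h0_gt0 stepP] := graphon_euler_step P rule_r.
exists (max_domain (velocity r)), (max_flow (velocity r)); split=> [W|W u Du|W].
- split; first exact: (max_flow_solution V_lip W).
  move=> I Psi PsiI; split=> [t It|t It]; first by exists I, Psi.
  by rewrite (max_flowE V_lip PsiI It).
- have DE := max_domain_flow V_lip Du; split=> // t; rewrite DE => Dt.
  exact: (max_domain_sub V_lip Du).2.
- move=> /graphonP Wg I_W.
  (* By [graphonP] the graphons form a closed ball, to which the invariance result for balls
     applies. *)
  rewrite (_ : I_W = [set t | max_domain (velocity r) W t /\
      `|max_flow (velocity r) W t - half_kernel P| <= 2^-1]).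
    exact: (max_flow_ball V_lip h0_gt0 stepP Wg).
  by apply/seteqP; split=> t [Dt /graphonP].
Qed.
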